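(* Let $a>0$ and let $u\in X$ be a radially symmetric positive solution of $$-\Delta u+a u=\frac{1}{2\pi}\Bigl[\ln\frac{1}{|\cdot|}*|u|^2\Bigr]u\qquad\text{in }\mathbb{R}^2 .$$ Set $M=\frac{1}{2\pi}\int_{\mathbb{R}^2}|u|^2$. Then there exists $\mu\in(0,+\infty)$ such that, as $|x|\to\infty$, $$u(x)=\frac{\mu+o(1)}{\sqrt{|x|}\,(\ln|x|)^{1/4}}\exp\biggl(-\sqrt{M}\,e^{-a/M}\int_1^{e^{a/M}|x|}\sqrt{\ln s}\,\mathrm{d}s\biggr).$$
   Context: $X=\{u\in H^1(\mathbb{R}^2)\;:\;\int_{\mathbb{R}^2}\ln(1+|x|)\,|u(x)|^2\,\mathrm{d}x<\infty\}$ (real-valued functions). The convolution is $\bigl[\ln\frac{1}{|\cdot|}*|u|^2\bigr](x)=\int_{\mathbb{R}^2}\ln\frac{1}{|x-y|}|u(y)|^2\,\mathrm{d}y$. Solutions in $X$ are classical solutions (of class $C^2(\mathbb{R}^2)$). ''Positive'' means $u>0$ everywhere. *)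

(* Defs.v *)
From HB Require Import structures.
From mathcomp Require Import all_boot all_order all_algebra.
From mathcomp Require Import all_classical all_reals all_analysis.

Set Implicit Arguments.
Unset Strict Implicit.
Unset Printing Implicit Defensive.

Import Order.TTheory GRing.Theory Num.Theory.
Import numFieldNormedType.Exports.

Local Open Scope classical_set_scope.
Local Open Scope ring_scope.

(* The library norm on [R * R] is the sup norm, so the Euclidean norm is
   defined separately; both induce the canonical topology. *)
Definition enorm (R : realType) (x : R * R) : R :=
  Num.sqrt (x.1 ^+ 2 + x.2 ^+ 2).

Definition enorm_infty (R : realType) : set_system (R * R) :=
  filter_from [set: R] (fun r => [set x | r < enorm x]).

Global Instance enorm_infty_filter (R : realType) :
  ProperFilter (@enorm_infty R).
Proof.
apply: filter_from_proper; first apply: filter_from_filter; first by exists 0.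
  move=> i j _ _; exists (Num.max i j) => // x /=.
  by rewrite gt_max => /andP[].
move=> r _; exists (`|r| + 1, 0) => /=.
rewrite /enorm /= expr0n addr0 sqrtr_sqr ger0_norm ?addr_ge0//.
by rewrite (le_lt_trans (ler_norm r))// ltrDl.
Qed.

Definition lebesgue2 (R : realType) :
    {measure set (measurableTypeR R * measurableTypeR R) -> \bar R} :=
  (@lebesgue_measure R \x @lebesgue_measure R)%E.

Definition partial1 (R : realType) (f : R * R -> R) : R * R -> R :=
  fun x => 'D_((1, 0) : R * R) f x.

Definition partial2 (R : realType) (f : R * R -> R) : R * R -> R :=
  fun x => 'D_((0, 1) : R * R) f x.

Fixpoint Ck (R : realType) (k : nat) (f : R * R -> R) : Prop :=
  if k is j.+1 then
    [/\ continuous f,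
        forall x, derivable f x ((1, 0) : R * R),
        forall x, derivable f x ((0, 1) : R * R),
        Ck j (partial1 f) & Ck j (partial2 f)]
  else continuous f.

Definition laplacian (R : realType) (f : R * R -> R) : R * R -> R :=
  fun x => partial1 (partial1 f) x + partial2 (partial2 f) x.

Definition test_function (R : realType) (phi : R * R -> R) : Prop :=
  (forall k, Ck k phi) /\ compact (closure [set x | phi x != 0]).

Definition weak_partials (R : realType) (u g1 g2 : R * R -> R) : Prop :=
  forall phi, test_function phi ->
    (\int[@lebesgue2 R]_x (u x * partial1 phi x)) =
      - (\int[@lebesgue2 R]_x (g1 x * phi x)) /\
    (\int[@lebesgue2 R]_x (u x * partial2 phi x)) =
      - (\int[@lebesgue2 R]_x (g2 x * phi x)).

Definition H1 (R : realType) (u : R * R -> R) : Prop :=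
  u \in Lfun (@lebesgue2 R) 2%:E /\
  exists g1 g2 : R * R -> R,
    [/\ g1 \in Lfun (@lebesgue2 R) 2%:E,
        g2 \in Lfun (@lebesgue2 R) 2%:E & weak_partials u g1 g2].

Definition spaceX (R : realType) (u : R * R -> R) : Prop :=
  H1 u /\
  (\int[@lebesgue2 R]_x (ln (1 + enorm x) * `|u x| ^+ 2)%:E < +oo)%E.

(* The integral is real-valued: it is absolutely convergent for continuous
   [u] with [spaceX u], and the point [y = x] is negligible. *)
Definition log_conv (R : realType) (u : R * R -> R) (x : R * R) : R :=
  \int[@lebesgue2 R]_y (ln (1 / enorm (x - y)) * `|u y| ^+ 2).

Definition is_solution (R : realType) (a : R) (u : R * R -> R) : Prop :=
  Ck 2 u /\
  forall x, - laplacian u x + a * u x = 1 / (2 * pi) * log_conv u x * u x.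

Definition radially_symmetric (R : realType) (u : R * R -> R) : Prop :=
  forall x y, enorm x = enorm y -> u x = u y.

(* Main.v *)
From HB Require Import structures.
Require Import Defs.
From mathcomp Require Import all_boot all_order all_algebra.
From mathcomp Require Import all_classical all_reals all_analysis.
From mathcomp Require Import measurable_realfun ring lra.
Import Order.TTheory GRing.Theory Num.Theory.
Import numFieldNormedType.Exports.
Local Open Scope classical_set_scope.
Local Open Scope ring_scope.

Set Implicit Arguments.
Unset Strict Implicit.
Unset Printing Implicit Defensive.

(** The profile [v] of [u] satisfies [v'' + v'/r = (a - V) v], where
    [V = log_conv u / (2 pi)] is radial because the equation determines it from
    [u] and its Laplacian.  Averaging [V] over an arc of the circle
    [|x| = r] tames the logarithmic singularity and gives [V -> -oo]; hence
    [w = sqrt r * v] is convex at infinity, square integrability forces it to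
    decrease, and it decays exponentially.  Averaging the kernel over [x] and
    [-x] then yields [V = - M ln r + O(1/r^2)], so [w'' = q w] with
    [q = Q + O(1/r^2)] and [Q = a + M ln r].  Comparing [w] with the WKB function
    [Q^(-1/4) exp (- S)], [S' = sqrt Q], through their Wronskian shows that the
    logarithm of their quotient has a derivative of order [1/r^2], hence a finite
    limit.  Finally [S] is the exponent of the statement after the change of
    variables [s = exp (a/M) r], and [Q ~ M ln r]. *)

(** Precision [O(1/r^2)] for [V] is what the comparison demands: an error of order [1/r] in [q]
    would only bound the logarithmic derivative of the quotient by [1 / (r sqrt(ln r))], which is
    not integrable. Pairing [x] with [- x] gains the missing power, and is legitimate because a
    radial [V] is even. The term [- 1/(4 r^2)] created by the Liouville substitution has the same
    admissible order.

    The start looks circular: decay of [u] needs [V -> -oo], while bounding the singular part of [V]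
    seems to need [u] bounded at infinity. The arc average breaks the circle. Near [x] the kernel is
    dominated by a function of the vertical distance [|x.2 - y.2|] alone, whose integral over the
    height of the arc is at most [4] whatever [y] is. The averaged singular part is thus at most
    four times the mass of [|u|^2], while the mass in a fixed square drives [V] down at a
    logarithmic rate. This crude rate gives [q >= 1], hence exponential decay, after which the
    moments needed for the sharp expansion are finite. *)

Section calculus.
Variable R : realType.
Implicit Types (f g : R -> R) (x a b : R).

Lemma is_derive1_mul f g x a b : is_derive x (1 : R) f a ->
  is_derive x (1 : R) g b ->
  is_derive x (1 : R) (fun r => f r * g r) (a * g x + f x * b).
Proof.
move=> fa gb; apply: (is_derive_eq (is_deriveM fa gb)).
by rewrite /GRing.scale/= addrC [g x * a]mulrC.
Qed.

Lemma is_derive1_add f g x a b : is_derive x (1 : R) f a ->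
  is_derive x (1 : R) g b -> is_derive x (1 : R) (fun r => f r + g r) (a + b).
Proof. exact: is_deriveD. Qed.

Lemma is_derive1_opp f x a : is_derive x (1 : R) f a ->
  is_derive x (1 : R) (fun r => - f r) (- a).
Proof. exact: is_deriveN. Qed.

Lemma is_derive1_cst (c x : R) : is_derive x (1 : R) (fun=> c) (0 : R).
Proof. exact: is_derive_cst. Qed.

Lemma is_derive1_scale (c x : R) : is_derive x (1 : R) (fun t => c * t) c.
Proof.
apply: (is_derive_eq
  (is_derive1_mul (is_derive1_cst c x) (is_derive_id x (1 : R)))).
by rewrite mul0r add0r mulr1.
Qed.

Lemma is_derive1_inv f x a : is_derive x (1 : R) f a -> f x != 0 ->
  is_derive x (1 : R) (fun r => (f r)^-1) (- a / f x ^+ 2).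
Proof.
move=> fa f0; apply: (is_derive_eq (is_deriveV f0 fa)).
by rewrite /GRing.scale/= mulNr mulrC mulNr.
Qed.

Lemma is_derive1_chain f g x a b : is_derive (g x) (1 : R) f a ->
  is_derive x (1 : R) g b ->
  is_derive x (1 : R) (fun r => f (g r)) (a * b).
Proof. exact: is_derive1_comp. Qed.

Lemma derivable_nondecreasing (f df : R -> R) (r0 : R) :
  (forall r, r0 < r -> is_derive r (1 : R) f (df r)) ->
  (forall r, r0 < r -> 0 <= df r) ->
  forall x y, r0 < x -> x <= y -> f x <= f y.
Proof.
move=> fdf df0 x y x0 xy.
have fd z : x <= z -> is_derive z (1 : R) f (df z).
  by move=> xz; apply: fdf; exact: lt_le_trans xz.
have [z|z zxy|z /andP[xz _] E] := @MVT_segment R f df x y xy.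
- by rewrite in_itv/= => /andP[/ltW xz _]; exact: fd.
- apply/(@continuous_in_subspaceT R R)=> {}z /set_mem/=.
  rewrite in_itv/= => /andP[xz _].
  apply: differentiable_continuous; apply/derivable1_diffP.
  by have [] := fd z xz.
rewrite -subr_ge0 E mulr_ge0 ?subr_ge0// df0//.
by rewrite (lt_le_trans x0).
Qed.

Lemma derivable_nonincreasing (f df : R -> R) (r0 : R) :
  (forall r, r0 < r -> is_derive r (1 : R) f (df r)) ->
  (forall r, r0 < r -> df r <= 0) ->
  forall x y, r0 < x -> x <= y -> f y <= f x.
Proof.
move=> fdf df0 x y x0 xy; rewrite -lerN2.
apply: (@derivable_nondecreasing (fun r => - f r) (fun r => - df r) r0) => //.
- by move=> r /fdf; exact: is_derive1_opp.
- by move=> r /df0; rewrite oppr_ge0.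
Qed.

(** Reads off the sign of a monotone quantity that vanishes at infinity, without passing to a
    limit. *)
Lemma le0_of_le_inv (h C r0 : R) :
  (forall r, r0 < r -> h <= C / r) -> h <= 0.
Proof.
move=> hC; rewrite leNgt; apply/negP => h0.
pose r := `|r0| + `|C| / h + 1.
have rr0 : r0 < r.
  rewrite (le_lt_trans (ler_norm r0))// /r -addrA ltrDl.
  by rewrite ltr_wpDl// divr_ge0// ltW.
have r_gt0 : 0 < r.
  by rewrite /r ltr_wpDl// addr_ge0// divr_ge0// ltW.
have := hC r rr0; rewrite ler_pdivlMr// /r.
rewrite !mulrDr mulr1 mulrCA divff ?gt_eqF// mulr1.
have := ler_norm C; have := normr_ge0 r0; nra.
Qed.

End calculus.

(** * Linear second-order equations *)

Section convex_ode.
Variables (R : realType) (w w1 q : R -> R) (r0 : R).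
Hypothesis wd : forall r, r0 < r -> is_derive r (1 : R) w (w1 r).
Hypothesis w1d : forall r, r0 < r -> is_derive r (1 : R) w1 (q r * w r).
Hypothesis w_gt0 : forall r, r0 < r -> 0 < w r.
Hypothesis q_ge1 : forall r, r0 < r -> 1 <= q r.

Lemma ode_slope_nondecreasing x y : r0 < x -> x <= y -> w1 x <= w1 y.
Proof.
apply: (derivable_nondecreasing w1d) => r rr.
by rewrite mulr_ge0 ?ltW ?w_gt0// (lt_le_trans ltr01)// q_ge1.
Qed.

(** By convexity, one positive slope persists. Such growth will contradict square integrability,
    which forces [w1 <= 0]. *)
Lemma ode_linear_growth r1 : r0 < r1 -> 0 < w1 r1 ->
  forall r, r1 + 1 <= r -> w1 r1 * (r - (r1 + 1)) <= w r.
Proof.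
move=> r01 w1_gt0 r rr.
have fd s : r1 < s ->
    is_derive s (1 : R) (fun t => w t - w1 r1 * t) (w1 s - w1 r1).
  move=> rs; apply: is_derive1_add; first by apply: wd; exact: lt_trans rs.
  by apply: is_derive1_opp; exact: is_derive1_scale.
have df0 s : r1 < s -> 0 <= w1 s - w1 r1.
  by move=> rs; rewrite subr_ge0 ode_slope_nondecreasing// ltW.
have r1S : r1 < r1 + 1 by rewrite ltrDl.
have := derivable_nondecreasing fd df0 r1S rr.
have := w_gt0 (lt_trans r01 r1S); lra.
Qed.

Hypothesis w1_le0 : forall r, r0 < r -> w1 r <= 0.

Lemma ode_nonincreasing x y : r0 < x -> x <= y -> w y <= w x.
Proof. exact: derivable_nonincreasing wd w1_le0 _ _. Qed.

Lemma is_derive1_expR_opp (r : R) :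
  is_derive r (1 : R) (fun t => expR (- t)) (- expR (- r)).
Proof.
apply: (is_derive_eq
  (is_derive1_chain (is_derive_expR (- r)) (is_derive1_opp (is_derive_id r 1)))).
by rewrite mulrN1.
Qed.

(** Factor [w'' - w] as [(d/dr - 1)(d/dr + 1) w]: the derivative of [exp(- r) (w' + w)] is
    [exp(- r) (q - 1) w >= 0], and this quantity is at most [exp(- s) w r] at any [s > r], so its
    supremum is at most [0]. Consequently [exp(r) w] is nonincreasing. *)
Lemma ode_slope_le r : r0 < r -> w1 r + w r <= 0.
Proof.
move=> rr.
have fd s : r0 < s -> is_derive s (1 : R)
    (fun t => expR (- t) * (w1 t + w t)) (expR (- s) * ((q s - 1) * w s)).
  move=> rs; apply: (is_derive_eq (is_derive1_mul (is_derive1_expR_opp s)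
      (is_derive1_add (w1d rs) (wd rs)))).
  by ring.
have df0 s : r0 < s -> 0 <= expR (- s) * ((q s - 1) * w s).
  by move=> rs; rewrite !mulr_ge0 ?expR_ge0 ?subr_ge0 ?q_ge1// ltW// w_gt0.
rewrite -(@pmulr_rle0 _ (expR (- r))) ?expR_gt0//.
apply: (@le0_of_le_inv R _ (w r) (Num.max r 0)) => s; rewrite gt_max => /andP[rs s0].
rewrite (le_trans (derivable_nondecreasing fd df0 rr (ltW rs)))//.
have sr0 := lt_trans rr rs.
rewrite (@le_trans _ _ (expR (- s) * w r))//.
  rewrite ler_wpM2l ?expR_ge0//.
  have := ode_nonincreasing rr (ltW rs); have := w1_le0 sr0; lra.
rewrite mulrC ler_wpM2l ?ltW ?w_gt0//.
rewrite expRN ltf_pV2 ?posrE ?expR_gt0//.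
by have := expR_ge1Dx s; lra.
Qed.

Lemma ode_exp_decay r1 r : r0 < r1 -> r1 <= r -> w r <= w r1 * expR (r1 - r).
Proof.
move=> r01 r1r.
have fd s : r0 < s ->
    is_derive s (1 : R) (fun t => expR t * w t) (expR s * (w1 s + w s)).
  move=> rs; apply: (is_derive_eq (is_derive1_mul (is_derive_expR s) (wd rs))).
  by ring.
have df0 s : r0 < s -> expR s * (w1 s + w s) <= 0.
  by move=> rs; rewrite pmulr_rle0 ?expR_gt0// ode_slope_le.
have := derivable_nonincreasing fd df0 r01 r1r.
by rewrite expRB mulrA ler_pdivlMr ?expR_gt0// ![w _ * _]mulrC.
Qed.

End convex_ode.

(** * WKB comparison for [w'' = q w] with [q] close to [a + M ln r] *)

Section wkb.
Variables (R : realType) (a M C r0 : R) (w w1 q S : R -> R).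
Hypothesis M_gt0 : 0 < M.
Hypothesis r0_ge1 : 1 <= r0.
Hypothesis wd : forall r, r0 < r -> is_derive r (1 : R) w (w1 r).
Hypothesis w1d : forall r, r0 < r -> is_derive r (1 : R) w1 (q r * w r).
Hypothesis w_gt0 : forall r, r0 < r -> 0 < w r.
Hypothesis w1_le0 : forall r, r0 < r -> w1 r <= 0.
Hypothesis q_ge1 : forall r, r0 < r -> 1 <= q r.
Let Q r := a + M * ln r.
Hypothesis Q_ge1 : forall r, r0 < r -> 1 <= Q r.
Hypothesis Sd : forall r, r0 < r -> is_derive r (1 : R) S (Num.sqrt (Q r)).
Hypothesis qQ : forall r, r0 < r -> `|q r - Q r| <= C / r ^+ 2.

(* Minus the logarithmic derivative of the WKB function [Q^(-1/4) exp (- S)]. *)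
Let P r := Num.sqrt (Q r) + M / 4 * (r * Q r)^-1.
Let P1 r := M / r / (2 * Num.sqrt (Q r)) - M / 4 * (Q r + M) / (r * Q r) ^+ 2.

Let r_gt0 r : r0 < r -> 0 < r.
Proof. by move=> rr; rewrite (lt_trans _ rr)// (lt_le_trans ltr01). Qed.

Let Q_gt0 r : r0 < r -> 0 < Q r.
Proof. by move=> rr; rewrite (lt_le_trans ltr01)// Q_ge1. Qed.

Let sq_ge1 r : r0 < r -> 1 <= Num.sqrt (Q r).
Proof.
move=> rr; rewrite -[leLHS](@sqrtr1 R) ler_sqrt ?Q_ge1//.
by rewrite ltW ?Q_gt0.
Qed.

Let Qd r : r0 < r -> is_derive r (1 : R) Q (M / r).
Proof.
move=> rr; apply: (is_derive_eq (is_derive1_add (is_derive1_cst a r)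
  (is_derive1_mul (is_derive1_cst M r) (is_derive1_ln (r_gt0 rr))))).
by rewrite mul0r !add0r.
Qed.

Let Pd r : r0 < r -> is_derive r (1 : R) P (P1 r).
Proof.
move=> rr; have rQ : r * Q r != 0.
  by rewrite mulf_neq0 ?gt_eqF ?Q_gt0 ?r_gt0.
apply: (is_derive_eq (is_derive1_add
  (is_derive1_chain (is_derive1_sqrt (Q_gt0 rr)) (Qd rr))
  (is_derive1_mul (is_derive1_cst (M / 4) r) (is_derive1_inv
    (is_derive1_mul (is_derive_id r (1 : R)) (Qd rr)) rQ)))).
rewrite /P1 /=; field.
by rewrite !gt_eqF ?sqrtr_gt0 ?Q_gt0 ?r_gt0//.
Qed.

Let P_ge1 r : r0 < r -> 1 <= P r.
Proof.
move=> rr; rewrite (le_trans (sq_ge1 rr))// lerDl.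
by rewrite ltW// mulr_gt0 ?divr_gt0 ?invr_gt0 ?mulr_gt0 ?(r_gt0 rr) ?Q_gt0.
Qed.

Let K := C + M ^+ 2 + M.

(** The exact [p = - w1 / w] solves [p^2 - p' = q]. In [P^2 - P'] the cross term [M / (2 r sqrt Q)]
    cancels the derivative of [sqrt Q], so every remaining correction to [Q] carries a factor
    [1/r^2]. In [K], [C] pays for [q - Q] and [M^2 + M] for these corrections. *)
Let riccati_defect r : r0 < r -> `|P r ^+ 2 - P1 r - q r| <= K / r ^+ 2.
Proof.
move=> rr; have Qr := Q_ge1 rr; have Q0 := Q_gt0 rr; have rp := r_gt0 rr.
have sE : Num.sqrt (Q r) ^+ 2 = Q r by rewrite sqr_sqrtr// ltW.
have s0 : 0 < Num.sqrt (Q r) by rewrite sqrtr_gt0.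
have -> : P r ^+ 2 - P1 r - q r = (Q r - q r) +
    (M ^+ 2 / 16 + M / 4 * (Q r + M)) / Q r ^+ 2 / r ^+ 2.
  rewrite /P /P1; move: sE s0 Q0; set s := Num.sqrt _; move: s (Q r).
  move=> s _ <- s0 _; field.
  by rewrite !gt_eqF.
rewrite (le_trans (ler_normD _ _))// distrC.
have -> : K / r ^+ 2 = C / r ^+ 2 + (M ^+ 2 + M) / r ^+ 2.
  by rewrite -mulrDl addrA.
rewrite lerD ?qQ//.
rewrite ger0_norm; last first.
  rewrite divr_ge0 ?exprn_ge0 ?(ltW rp)// divr_ge0 ?exprn_ge0 ?(ltW Q0)//.
  by have := M_gt0; nra.
rewrite ler_pM2r ?invr_gt0 ?exprn_gt0// ler_pdivrMr ?exprn_gt0//.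
have h1 : M * Q r <= M * Q r ^+ 2 by rewrite ler_pM2l// ler_eXnr.
have h2 : M ^+ 2 * 1 <= M ^+ 2 * Q r ^+ 2.
  by rewrite ler_pM2l ?exprn_gt0// exprn_ege1.
have h3 : 0 <= M * Q r by rewrite mulr_ge0 ?ltW.
have := M_gt0; nra.
Qed.

Let phi r := expR (- (S r + ln (Q r) / 4)).

Let phid r : r0 < r -> is_derive r (1 : R) phi (- (P r * phi r)).
Proof.
move=> rr; have Q0 := Q_gt0 rr; have rp := r_gt0 rr.
apply: (is_derive_eq (is_derive1_chain (is_derive_expR _)
  (is_derive1_opp (is_derive1_add (Sd rr) (is_derive1_mul
    (is_derive1_chain (is_derive1_ln Q0) (Qd rr))
    (is_derive1_cst (4^-1) r)))))).
rewrite mulr0 addr0 mulrN mulrC; congr (- (_ * _)); rewrite /P; congr (_ + _).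
by rewrite invfM; ring.
Qed.

(* [H k] is [phi * w * (p - P + k / r^2)] with [p = - w1 / w]: it is monotone for
   [k = K] and [k = - K] and vanishes at infinity, which bounds [p - P]. *)
Let H k r := phi r * (- w1 r - P r * w r + k * w r / r ^+ 2).

Let Hd k r : r0 < r -> is_derive r (1 : R) (H k)
  (phi r * (w r * (P r ^+ 2 - P1 r - q r - k * P r / r ^+ 2 - 2 * k / r ^+ 3)
            + k * w1 r / r ^+ 2)).
Proof.
move=> rr; have rp := r_gt0 rr.
have r2 : r * r != 0 by rewrite gt_eqF// mulr_gt0.
have d : is_derive r (1 : R)
    (fun r => phi r * (- w1 r - P r * w r + k * w r * (r * r)^-1)) _ :=
  is_derive1_mul (phid rr) (is_derive1_add (is_derive1_add
    (is_derive1_opp (w1d rr))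
    (is_derive1_opp (is_derive1_mul (Pd rr) (wd rr))))
    (is_derive1_mul (is_derive1_mul (is_derive1_cst k r) (wd rr))
      (is_derive1_inv
        (is_derive1_mul (is_derive_id r (1 : R)) (is_derive_id r (1 : R))) r2))).
have -> : H k = (fun r => phi r * (- w1 r - P r * w r + k * w r * (r * r)^-1)).
  by apply/funext => s; rewrite /H expr2.
apply: (is_derive_eq d).
rewrite /=; field.
by rewrite gt_eqF.
Qed.

(** [phi] is [O(exp(- r))], since [sqrt Q >= 1] makes [S - r] nondecreasing, whereas the other
    factor grows at most linearly: [w] and [w1] stay bounded and [P] is at most linear. *)
Let H_small k : exists D, forall r, r0 + 1 < r -> `|H k r| <= D / r.
Proof.
pose r1 := r0 + 1; have r01 : r0 < r1 by rewrite ltrDl.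
pose B := `|w1 r1| + (`|a| + M + M) * w r1 + `|k| * w r1.
exists (expR (r1 - S r1) * (4 * B)) => r r1r.
have rr : r0 < r := lt_trans r01 r1r.
have rp := r_gt0 rr; have Q0 := Q_gt0 rr.
have r_ge1 : 1 <= r by rewrite (le_trans r0_ge1)// ltW.
have wr : w r <= w r1 by exact: (ode_nonincreasing wd w1_le0 r01 (ltW r1r)).
have w10 := w_gt0 r01; have w0 := w_gt0 rr.
have B0 : 0 <= B.
  by rewrite !addr_ge0 ?mulr_ge0 ?addr_ge0 ?(ltW M_gt0) ?(ltW w10).
have phi_le : phi r <= expR (r1 - S r1) * expR (- r).
  rewrite -expRD ler_expR.
  have : S r1 - r1 <= S r - r.
    apply: (@derivable_nondecreasing R (fun r => S r - r)
      (fun r => Num.sqrt (Q r) - 1) r0) => //; last exact: ltW.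
    - move=> t rt; exact: (is_derive1_add (Sd rt)).
    - by move=> t rt; rewrite subr_ge0 sq_ge1.
  by have := ln_ge0 (Q_ge1 rr); lra.
have P_le : P r <= (`|a| + M + M) * r.
  have : Num.sqrt (Q r) <= Q r.
    rewrite -[leRHS]sqr_sqrtr ?(ltW Q0)// expr2 ler_peMl ?sq_ge1//.
  have : M / 4 * (r * Q r)^-1 <= M.
    rewrite ler_pdivrMr ?mulr_gt0// -[leLHS]mulr1 ler_pM ?divr_ge0 ?(ltW M_gt0)//.
      by have := M_gt0; lra.
    by rewrite -[1]mulr1 ler_pM ?Q_ge1.
  have : ln r <= r by rewrite ltW// ln_sublinear.
  rewrite /P /Q; have := ler_norm a; have := normr_ge0 a.
  have := M_gt0; nra.
have P0 : 0 <= P r by rewrite (le_trans ler01)// P_ge1.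
have w1r : `|w1 r| <= `|w1 r1|.
  rewrite !ler0_norm ?w1_le0// lerN2.
  exact: (ode_slope_nondecreasing w1d w_gt0 q_ge1 r01 (ltW r1r)).
have br : `| - w1 r - P r * w r + k * w r / r ^+ 2| <= B * (1 + r).
  rewrite (le_trans (ler_normD _ _))//.
  have e1 : `|k * w r / r ^+ 2| <= `|k| * w r1.
    rewrite !normrM (gtr0_norm w0) normfV -mulrA ler_wpM2l//.
    rewrite -[leRHS]mulr1 ler_pM ?(ltW w0)//.
    by rewrite ger0_norm ?exprn_ge0 ?(ltW rp)// invf_le1 ?exprn_gt0// exprn_ege1.
  have e2 : `|- w1 r - P r * w r| <= `|w1 r1| + (`|a| + M + M) * w r1 * r.
    rewrite (le_trans (ler_normB _ _))// normrN lerD//.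
    rewrite normrM (ger0_norm P0) (gtr0_norm w0) mulrAC ler_pM ?(ltW w0)//.
  rewrite (le_trans (lerD e2 e1))// /B !mulrDl !mulrDr !mulr1.
  have := normr_ge0 (w1 r1); have : 0 <= `|k| * w r1 by rewrite mulr_ge0 ?(ltW w10).
  have : 0 <= (`|a| + M + M) * w r1.
    by rewrite mulr_ge0 ?addr_ge0 ?(ltW M_gt0) ?(ltW w10).
  nra.
rewrite /H normrM (gtr0_norm (expR_gt0 _)).
rewrite (le_trans (ler_pM (expR_ge0 _) _ phi_le br))//.
have e4 : expR (- r) * (1 + r) <= 4 / r.
  rewrite ler_pdivlMr// expRN -mulrA mulrC ler_pdivrMr ?expR_gt0//.
  have := expR_ge1Dxn 1 (ltW rp).
  by rewrite (_ : 2`!%:R = 2 :> R)//; nra.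
rewrite [leLHS](_ : _ = expR (r1 - S r1) * B * (expR (- r) * (1 + r))); last by ring.
rewrite [leRHS](_ : _ = expR (r1 - S r1) * B * (4 / r)); last by ring.
by rewrite ler_wpM2l// mulr_ge0// expR_ge0.
Qed.

(** Since [P >= 1], the term [k P] absorbs the Riccati defect, which is at most [k]; the terms in
    [2 / s] and [w1 <= 0] reinforce the sign. *)
Let H_slope_sign s : r0 < s -> let k := K / s ^+ 2 in
  let e := P s ^+ 2 - P1 s - q s in
  w s * (e - k * P s - k * (2 / s)) + k * w1 s <= 0 /\
  0 <= w s * (e + k * P s + k * (2 / s)) - k * w1 s.
Proof.
move=> rs k e; have s0 := r_gt0 rs.
have := riccati_defect rs; rewrite -/e -/k => ek.
have k0 : 0 <= k by exact: le_trans ek.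
have [e1 e2] : - k <= e /\ e <= k by move/ler_normlP : ek => []; lra.
have w0 := w_gt0 rs; have w10 := w1_le0 rs.
have kP : k <= k * P s by rewrite ler_peMr ?P_ge1.
have k2 : 0 <= k * (2 / s) by rewrite mulr_ge0// divr_ge0// ltW.
have kw : k * w1 s <= 0 by rewrite mulr_ge0_le0.
split.
  by rewrite -(addr0 0) lerD// pmulr_rle0//; lra.
by rewrite subr_ge0 (le_trans kw)// pmulr_rge0//; lra.
Qed.

Let H_ge0 r : r0 < r -> 0 <= H K r.
Proof.
move=> rr; have [D HD] := H_small K.
have dH_le0 s : r0 < s -> phi s *
    (w s * (P s ^+ 2 - P1 s - q s - K * P s / s ^+ 2 - 2 * K / s ^+ 3)
     + K * w1 s / s ^+ 2) <= 0.
  move=> rs; have [+ _] := H_slope_sign rs.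
  have s0 := r_gt0 rs; rewrite pmulr_rle0 ?expR_gt0//; apply: le_trans.
  by rewrite le_eqVlt; apply/orP; left; apply/eqP; field; rewrite gt_eqF.
rewrite -oppr_le0; apply: (@le0_of_le_inv R _ D (Num.max r (r0 + 1))) => s.
rewrite gt_max => /andP[rs r0s].
rewrite (le_trans _ (HD s r0s))// (@le_trans _ _ (- H K s))//; last first.
  by rewrite ler_normr lexx orbT.
by rewrite lerN2; exact: (derivable_nonincreasing (@Hd K) dH_le0 rr (ltW rs)).
Qed.

Let H_le0 r : r0 < r -> H (- K) r <= 0.
Proof.
move=> rr; have [D HD] := H_small (- K).
have dH_ge0 s : r0 < s -> 0 <= phi s *
    (w s * (P s ^+ 2 - P1 s - q s - (- K) * P s / s ^+ 2 - 2 * (- K) / s ^+ 3)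
     + (- K) * w1 s / s ^+ 2).
  move=> rs; have [_] := H_slope_sign rs.
  have s0 := r_gt0 rs; rewrite pmulr_rge0 ?expR_gt0//.
  move=> /le_trans; apply.
  by rewrite le_eqVlt; apply/orP; left; apply/eqP; field; rewrite gt_eqF.
apply: (@le0_of_le_inv R _ D (Num.max r (r0 + 1))) => s.
rewrite gt_max => /andP[rs r0s].
rewrite (le_trans _ (HD s r0s))// (le_trans _ (ler_norm _))//.
exact: (derivable_nondecreasing (@Hd (- K)) dH_ge0 rr (ltW rs)).
Qed.

(** Logarithm of [w / phi], the quotient by the WKB function. *)
Let L r := ln (w r) + S r + ln (Q r) / 4.

Let Ld r : r0 < r -> is_derive r (1 : R) L (w1 r / w r + P r).
Proof.
move=> rr; have Q0 := Q_gt0 rr; have rp := r_gt0 rr.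
apply: (is_derive_eq (is_derive1_add (is_derive1_add
    (is_derive1_chain (is_derive1_ln (w_gt0 rr)) (wd rr)) (Sd rr))
    (is_derive1_mul (is_derive1_chain (is_derive1_ln Q0) (Qd rr))
    (is_derive1_cst (4^-1) r)))).
by rewrite /P; field; rewrite !gt_eqF ?w_gt0.
Qed.

Let L_slope r : r0 < r -> `|w1 r / w r + P r| <= K / r ^+ 2.
Proof.
move=> rr; have w0 := w_gt0 rr; have rp := r_gt0 rr.
have := H_ge0 rr; have := H_le0 rr.
rewrite /H pmulr_rle0 ?pmulr_rge0 ?expR_gt0// => l u.
apply/ler_normlP; split.
  rewrite -(ler_pM2r w0) -subr_le0 (le_trans _ l)// le_eqVlt; apply/orP; left.
  by apply/eqP; field; rewrite !gt_eqF.
rewrite -(ler_pM2r w0) -subr_ge0 (le_trans u)// le_eqVlt; apply/orP; left.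
by apply/eqP; field; rewrite !gt_eqF.
Qed.

(** [L - K/r] is nondecreasing and [L + K/r] nonincreasing; the second bounds the first from above,
    so the first converges, and [K/r] tends to [0]. *)
Lemma wkb_asymptotics :
  exists l : R, ln (w r) + S r + ln (a + M * ln r) / 4 @[r --> +oo] --> l.
Proof.
have Kd k r : r0 < r ->
    is_derive r (1 : R) (fun r => L r + k * r^-1) (w1 r / w r + P r - k / r ^+ 2).
  move=> rr; have rp : r != 0 by rewrite gt_eqF ?r_gt0.
  apply: (is_derive_eq (is_derive1_add (Ld rr) (is_derive1_mul
    (is_derive1_cst k r) (is_derive1_inv (is_derive_id r (1 : R)) rp)))).
  by congr (_ + _); field.
have up : forall x y, r0 < x -> x <= y -> L x - K * x^-1 <= L y - K * y^-1.
  move=> x y rx xy; rewrite -!mulNr.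
  apply: (derivable_nondecreasing (@Kd (- K)) _ rx xy) => r rr.
  by have := L_slope rr => /ler_normlP[]; lra.
have dn : forall x y, r0 < x -> x <= y -> L y + K * y^-1 <= L x + K * x^-1.
  move=> x y rx xy; apply: (derivable_nonincreasing (@Kd K) _ rx xy) => r rr.
  by have := L_slope rr => /ler_normlP[]; lra.
have K0 : 0 <= K.
  have r1 : r0 < r0 + 1 by rewrite ltrDl.
  have : 0 <= K / (r0 + 1) ^+ 2 by exact: le_trans (L_slope r1).
  by rewrite pmulr_lge0// invr_gt0 exprn_gt0// r_gt0.
(* Freezing the argument below [r0 + 1] makes the function monotone on the whole line, as
   [nondecreasing_cvgr] expects. *)
pose f r := L (Num.max r (r0 + 1)) - K * (Num.max r (r0 + 1))^-1.
have r0m r : r0 < Num.max r (r0 + 1) by rewrite lt_max ltrDl ltr01 orbT.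
have fnd : nondecreasing_fun f.
  by move=> x y xy; apply: up => //; rewrite ge_max !le_max lexx xy orbT.
have fub : has_ubound (range f).
  exists (L (r0 + 1) + K * (r0 + 1)^-1) => _ [r _ <-].
  rewrite (le_trans _ (dn _ (Num.max r (r0 + 1)) _ _))// ?ltrDl//.
    rewrite lerD2l (@le_trans _ _ 0) ?oppr_le0// mulr_ge0// invr_ge0 ltW ?r_gt0//.
  by rewrite le_max lexx orbT.
exists (sup (range f)); have fl := nondecreasing_cvgr fnd fub.
have Kinv : K * r^-1 @[r --> +oo] --> (0 : R).
  rewrite -(mulr0 K); apply: cvgM; first exact: cvg_cst.
  by apply/gtr0_cvgV0; [exact: nbhs_pinfty_gt|exact: cvg_id].
rewrite -[sup _]addr0; apply: cvg_trans (cvgD fl Kinv).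
apply: near_eq_cvg; near=> r.
rewrite -[LHS]/(f r + K / r) /f.
have -> : Num.max r (r0 + 1) = r; last by rewrite subrK.
  apply/max_idPl.
  by near: r; apply: nbhs_pinfty_ge; rewrite num_real.
Unshelve. all: by end_near. Qed.

End wkb.

(** * Logarithmic potentials *)

Lemma sigma_finite_lebesgue2 (R : realType) : sigma_finite setT (@lebesgue2 R).
Proof.
pose I (n : nat) : set (measurableTypeR R) := `[- n%:R, n%:R]%classic.
have mI n : measurable (I n) by exact: measurable_itv.
exists (fun n => I n `*` I n).
  rewrite eqEsubset; split=> // -[x y] _.
  pose n := maxn (Num.truncn `|x|).+1 (Num.truncn `|y|).+1.
  have bound z : (Num.truncn `|z| < n)%N -> I n z.
    move=> zn; rewrite /I/= in_itv/= -ler_norml.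
    have /andP[_ h] := truncn_itv (normr_ge0 z).
    by rewrite (le_trans (ltW h))// ler_nat.
  by exists n => //=; split; apply: bound; rewrite /n leq_max leqnn ?orbT.
move=> n; split; first exact: measurableX.
have mu_lty : (@lebesgue_measure R (I n) < +oo)%E.
  by rewrite lebesgue_measure_itv/= lte_fin; case: ifP => _; rewrite -?EFinD ?ltry.
rewrite [X in (X < _)%E](_ : _ =
  @lebesgue_measure R (I n) * @lebesgue_measure R (I n))%E.
  by rewrite lte_mul_pinfty// ge0_fin_numE.
exact: product_measure1E.
Qed.

(* The library's sigma-finite structure on product measures is shadowed by the
   one on products of subprobabilities, hence this copy of [lebesgue2]. *)
Definition lebesgue2_sf (R : realType) :
  set (measurableTypeR R * measurableTypeR R)%type -> \bar R := @lebesgue2 R.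

HB.instance Definition _ (R : realType) :=
  Measure.copy (@lebesgue2_sf R) (@lebesgue2 R).

HB.instance Definition _ (R : realType) :=
  Measure_isSigmaFinite.Build _ _ _ (@lebesgue2_sf R)
    (@sigma_finite_lebesgue2 R).

(** * Integrable majorants of the logarithmic singularity *)

Section log_majorant.
Variable R : realType.
Notation mu := (@lebesgue_measure R).
Implicit Types s t z : R.

Definition ln_neg z : R := Num.max 0 (- ln z).

Lemma ln_neg_ge0 z : 0 <= ln_neg z.
Proof. by rewrite /ln_neg le_max lexx. Qed.

Lemma ln_neg_eq0 z : 1 <= z -> ln_neg z = 0.
Proof. by move=> z1; apply/max_idPl; rewrite oppr_le0 ln_ge0. Qed.

(* Majorizes [- ln |t|] even at [t = 0], where [ln] has the junk value [0] but
   this series is infinite. *)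
Definition log_layers t : \bar R :=
  (\sum_(k <oo) (\1_[set s : R | (`|s| <= (2 ^ k)%:R^-1)%R] t)%:E)%E.

Lemma log_layers_ge0 t : (0 <= log_layers t)%E.
Proof. by apply: nneseries_ge0 => n _ _; rewrite lee_fin. Qed.

Lemma eq_indic (T1 T2 : Type) (A : set T1) (B : set T2) x y :
  (A x <-> B y) -> \1_A x = \1_B y :> R.
Proof.
move=> AB; rewrite !indicE; have -> // : (x \in A) = (y \in B).
by apply/idP/idP => /set_mem /AB /mem_set.
Qed.

(** With [n] the integer part of [- ln z], one has [|t| <= z <= exp(- n) <= 2^(- n)], so [t] lies in
    the layers [0] to [n], which contribute [n + 1 > - ln z]. Only [|t| <= z] is required, so that
    [z] can be a Euclidean distance and [t] one of its coordinates. *)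
Lemma ln_neg_le_layers z t : `|t| <= z -> ((ln_neg z)%:E <= log_layers t)%E.
Proof.
move=> tz; have z_ge0 : 0 <= z by exact: le_trans tz.
have [->|z_neq0] := eqVneq z 0.
  by rewrite /ln_neg ln0// oppr0 maxxx log_layers_ge0.
have z0 : 0 < z by rewrite lt_neqAle eq_sym z_neq0.
have [z1|z1] := leP 1 z; first by rewrite ln_neg_eq0// log_layers_ge0.
have lz : 0 <= - ln z by rewrite oppr_ge0 ln_le0// ltW.
rewrite /ln_neg; have -> : Num.max 0 (- ln z) = - ln z by apply/max_idPr.
have /andP[n1 n2] := truncn_itv lz.
set n := Num.truncn _ in n1 n2.
apply: (@le_trans _ _ (\sum_(0 <= k < n.+1)
    (\1_[set s : R | (`|s| <= (2 ^ k)%:R^-1)%R] t)%:E)%E); last first.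
  by apply: nneseries_lim_ge => k _ _; rewrite lee_fin.
rewrite sumEFin lee_fin (le_trans (ltW n2))//.
rewrite (eq_big_nat _ _ (F2 := fun=> 1)).
  by rewrite sumr_const_nat subn0.
move=> k /=; rewrite ltnS => kn.
rewrite indicE mem_set//= (le_trans tz)//.
rewrite -[leLHS]lnK ?posrE// -[X in expR X]opprK expRN.
rewrite lef_pV2 ?posrE ?expR_gt0 ?ltr0n ?expn_gt0//.
rewrite (@le_trans _ _ (2 ^ n)%:R)//; first by rewrite ler_nat leq_exp2l.
rewrite (@le_trans _ _ (expR n%:R))// ?ler_expR//.
rewrite -[n%:R]mulr1 expRM_natl natrX lerXn2r ?nnegrE ?expR_ge0//.
by have := expR_ge1Dx (1 : R); lra.
Qed.

Lemma measurable_log_layers : measurable_fun setT log_layers.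
Proof.
have := @ge0_emeasurable_sum _ (measurableTypeR R) R setT
  (fun k t => (\1_[set s : R | (`|s| <= (2 ^ k)%:R^-1)%R] t)%:E) xpredT.
apply => //.
move=> k _; apply/measurable_EFinP/measurable_indic.
have -> : [set s : R | `|s| <= (2 ^ k)%:R^-1] =
    `[- (2 ^ k)%:R^-1, (2 ^ k)%:R^-1]%classic.
  by apply/seteqP; split=> x /=; rewrite in_itv/= ler_norml.
exact: measurable_itv.
Qed.

Lemma integral_log_layers s : (\int[mu]_t log_layers (t - s)%R <= 4%:E)%E.
Proof.
have mI k : measurable [set t : R | `|t - s| <= (2 ^ k)%:R^-1] /\
    (mu [set t : R | (`|t - s| <= (2 ^ k)%:R^-1)%R] =
     (4 / (2 ^ k.+1)%:R)%:E)%E.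
  have -> : [set t : R | `|t - s| <= (2 ^ k)%:R^-1] =
      `[s - (2 ^ k)%:R^-1, s + (2 ^ k)%:R^-1]%classic.
    by apply/seteqP; split=> x /=; rewrite in_itv/= ler_distl.
  split; first exact: measurable_itv.
  have k0 : 0 < (2 ^ k)%:R^-1 :> R by rewrite invr_gt0 ltr0n expn_gt0.
  rewrite lebesgue_measure_itv/= lte_fin ifT; last by lra.
  rewrite -EFinD; congr EFin; rewrite expnS natrM; field.
  by rewrite pnatr_eq0 expn_eq0.
have E t : log_layers (t - s) =
    (\sum_(k <oo) (\1_[set t : R | (`|t - s| <= (2 ^ k)%:R^-1)%R] t)%:E)%E.
  by apply: eq_eseriesr => n _; congr EFin; exact: eq_indic.
under eq_integral do rewrite E.
rewrite integral_nneseries//; last first.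
  by move=> k; apply/measurable_EFinP/measurable_indic; have [] := mI k.
(* Layer [k] has length [2 / 2^k], written [4 / 2^(k+1)] to match the geometric series of total
   [4]. *)
rewrite (le_trans _ (epsilon_trick0 xpredT _))//.
rewrite le_eqVlt; apply/orP; left; apply/eqP; apply: eq_eseriesr => k _.
by have [mk mE] := mI k; rewrite integral_indic// setIT.
Qed.

Lemma integral_oneDsqrV : (\int[mu]_t ((oneDsqr t)^-1)%:E = pi%:E)%E.
Proof.
rewrite ge0_symfun_integralT.
- rewrite (_ : [set x : R | 0 <= x] = `[0, +oo[%classic); last first.
    by apply/seteqP; split=> x /=; rewrite in_itv/= andbT.
  by rewrite integral0y_oneDsqr -EFinM; congr EFin; field.
- by move=> x; rewrite invr_ge0 (le_trans ler01)// oneDsqr_ge1.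
- exact: continuous_oneDsqrV.
- by move=> x /=; rewrite /oneDsqr sqrrN.
Qed.

Lemma integral_lebesgue2_prod (f g : R -> \bar R) :
  measurable_fun setT f -> measurable_fun setT g ->
  (forall t, 0 <= f t)%E -> (forall t, 0 <= g t)%E ->
  (\int[@lebesgue2 R]_y (f y.1 * g y.2) =
   (\int[mu]_t f t) * (\int[mu]_t g t))%E.
Proof.
move=> mf mg f0 g0.
rewrite /lebesgue2 fubini_tonelli1/=.
- rewrite /fubini_F/=; under eq_integral do rewrite ge0_integralZl//.
  by rewrite ge0_integralZr// integral_ge0.
- apply: emeasurable_funM; first exact: measurableT_comp.
  exact: measurableT_comp.
- by move=> x; rewrite mule_ge0.
Qed.

End log_majorant.

(** * The Euclidean norm and pointwise bounds on the logarithmic kernel *)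

Section euclidean_norm.
Variable R : realType.
Implicit Types x y : R * R.

Lemma enorm_ge0 x : 0 <= enorm x.
Proof. exact: sqrtr_ge0. Qed.

Lemma enorm_sqr x : enorm x ^+ 2 = x.1 ^+ 2 + x.2 ^+ 2.
Proof. by rewrite sqr_sqrtr// addr_ge0 ?sqr_ge0. Qed.

Lemma enormN x : enorm (- x) = enorm x.
Proof. by rewrite /enorm/= !sqrrN. Qed.

Lemma enormBC x y : enorm (x - y) = enorm (y - x).
Proof. by rewrite -enormN opprB. Qed.

Lemma normr_fst_le_enorm x : `|x.1| <= enorm x.
Proof.
by rewrite -[leLHS]sqrtr_sqr ler_sqrt ?lerDl ?addr_ge0 ?sqr_ge0.
Qed.

Lemma normr_snd_le_enorm x : `|x.2| <= enorm x.
Proof.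
by rewrite -[leLHS]sqrtr_sqr ler_sqrt ?lerDr ?addr_ge0 ?sqr_ge0.
Qed.

Lemma dot_le_enorm x y :
  - (enorm x * enorm y) <= x.1 * y.1 + x.2 * y.2 <= enorm x * enorm y.
Proof.
rewrite -ler_norml -(@ler_pXn2r _ 2) ?nnegrE ?mulr_ge0 ?enorm_ge0//.
rewrite real_normK ?num_real// exprMn !enorm_sqr -subr_ge0.
rewrite [leRHS](_ : _ = (x.1 * y.2 - x.2 * y.1) ^+ 2) ?sqr_ge0//.
by ring.
Qed.

Lemma ler_enormB x y : enorm (x - y) <= enorm x + enorm y.
Proof.
rewrite -(@ler_pXn2r _ 2) ?nnegrE ?addr_ge0 ?enorm_ge0//.
rewrite sqrrD !enorm_sqr/=.
by have /andP[+ _] := dot_le_enorm x y; lra.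
Qed.

Lemma ler_enorm_sub x y : enorm x - enorm y <= enorm (x - y).
Proof.
by have := ler_enormB (x - y) (- y); rewrite opprK subrK enormN lerBlDr.
Qed.

Lemma measurable_enormB x :
  measurable_fun (setT : set (measurableTypeR R * measurableTypeR R))
    (fun y : measurableTypeR R * measurableTypeR R => enorm (x - y)).
Proof.
apply: (@measurableT_comp _ _ _ _ _ _ (@Num.sqrt R)).
  by apply: continuous_measurable_fun; exact: sqrt_continuous.
apply: measurable_funD; apply: measurable_funX; apply: measurable_funB => //.
Qed.

(** The point [s = 0] is covered because [1 / 0] and [ln 0] both default to [0]. *)
Lemma ln_div1 (s : R) : 0 <= s -> ln (1 / s) = - ln s.
Proof.
rewrite le_eqVlt => /predU1P[<-|s0]; last by rewrite div1r lnV.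
by rewrite invr0 mulr0 ln0// oppr0.
Qed.

Lemma normr_ln_le (s : R) : 0 <= s -> `|ln s| <= ln_neg s + ln (1 + s).
Proof.
rewrite le_eqVlt => /predU1P[<-|s0].
  by rewrite addr0 ln0// ln1 normr0 addr0 ln_neg_ge0.
have : ln s <= ln (1 + s) by rewrite ler_ln ?posrE ?addr_gt0// lerDr.
have : 0 <= ln (1 + s) by rewrite ln_ge0// lerDl ltW.
have : - ln s <= ln_neg s by rewrite /ln_neg le_max lexx orbT.
have := ln_neg_ge0 s; rewrite ler_norml; lra.
Qed.

Let normr_ln_near1 (n s : R) : 0 <= s -> s <= 1 / 2 -> 1 - s <= n -> n <= 1 + s ->
  `|ln n| <= 2 * s.
Proof.
move=> s0 s1 n1 n2; have n0 : 0 < n by lra.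
have a : ln n <= n - 1.
  by have := @le_ln1Dx R (n - 1); rewrite [1 + _]addrC subrK; apply; lra.
have b : - ln n <= n^-1 - 1.
  have ni : 0 < n^-1 by rewrite invr_gt0.
  rewrite -lnV//; have := @le_ln1Dx R (n^-1 - 1).
  by rewrite [1 + _]addrC subrK; apply; lra.
have c : n^-1 - 1 <= 2 * s.
  have -> : n^-1 - 1 = (1 - n) / n by field; rewrite gt_eqF.
  by rewrite ler_pdivrMr//; nra.
by rewrite ler_norml; lra.
Qed.

(* Averaging the kernel over [x] and [- x] cancels the first-order term of its
   expansion in [y / x]. *)
Lemma sym_log_kernel_le x y : 1 <= enorm x ->
  enorm x ^+ 2 * `|ln (1 / enorm (x - y)) + ln (1 / enorm (- x - y)) +
                   2 * ln (enorm x)| <=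
  2 * enorm y ^+ 2 + 20 * enorm y ^+ 3 +
  2 * enorm y ^+ 2 * (ln_neg (enorm (x - y)) + ln_neg (enorm (- x - y))).
Proof.
move=> x1; rewrite !ln_div1 ?enorm_ge0//.
have := ler_enormB x y; have := ler_enormB (- x) y; rewrite enormN.
have := ler_enorm_sub x y; have := ler_enorm_sub (- x) y; rewrite enormN.
have := dot_le_enorm x y.
have := enorm_sqr x; have := enorm_sqr y.
have := enorm_sqr (x - y); have := enorm_sqr (- x - y).
have := enorm_ge0 y; have := enorm_ge0 (x - y); have := enorm_ge0 (- x - y).
move: (enorm x) (enorm y) (enorm (x - y)) (enorm (- x - y)) x1 => n N s t n1.
move=> t0 s0 N0 /= tE sE NE nE /andP[d1 d2] tl sl tu su.
have n0 : 0 < n by lra.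
have n20 : 0 < n ^+ 2 by rewrite exprn_gt0.
have ls := ln_neg_ge0 s; have lt := ln_neg_ge0 t.
have N2 : 0 <= N ^+ 2 by rewrite sqr_ge0.
have N3 : 0 <= N ^+ 3 by rewrite exprn_ge0.
(* Far regime: [(s t)^2 = (n^2 + N^2)^2 - 4 (x.y)^2] places [s t / n^2] within [N^2 / n^2 <= 1/2] of
   [1], so its logarithm is at most [2 N^2 / n^2] in absolute value. *)
have [h|h] := leP (2 * N ^+ 2) (n ^+ 2).
  have Nn : N < n by rewrite -(@ltr_pXn2r _ 2) ?nnegrE ?(ltW n0)//; nra.
  have s_gt0 : 0 < s by lra.
  have t_gt0 : 0 < t by lra.
  have -> : - ln s + - ln t + 2 * ln n = - ln (s * t / n ^+ 2).
    rewrite ln_div ?posrE ?mulr_gt0// lnM ?posrE// lnXn// mulr_natl.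
    by rewrite !opprD opprK.
  rewrite normrN.
  have stE : (s * t) ^+ 2 =
      (n ^+ 2 + N ^+ 2) ^+ 2 - 4 * (x.1 * y.1 + x.2 * y.2) ^+ 2.
    by rewrite exprMn sE tE nE NE; ring.
  have d : (x.1 * y.1 + x.2 * y.2) ^+ 2 <= (n * N) ^+ 2.
    have : `|x.1 * y.1 + x.2 * y.2| <= n * N by rewrite ler_norml d1 d2.
    by rewrite -(@ler_pXn2r _ 2) ?nnegrE ?mulr_ge0 ?(ltW n0)// real_normK ?num_real.
  have st_ub : s * t <= n ^+ 2 + N ^+ 2.
    rewrite -(@ler_pXn2r _ 2) ?nnegrE ?mulr_ge0 ?addr_ge0 ?sqr_ge0// stE.
    by rewrite gerBl mulr_ge0// sqr_ge0.
  have st_lb : n ^+ 2 - N ^+ 2 <= s * t.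
    rewrite -(@ler_pXn2r _ 2) ?nnegrE ?mulr_ge0//; last by lra.
    by rewrite stE; lra.
  have k : `|ln (s * t / n ^+ 2)| <= 2 * (N ^+ 2 / n ^+ 2).
    apply: normr_ln_near1.
    - by rewrite divr_ge0// ltW.
    - by rewrite ler_pdivrMr//; lra.
    - rewrite ler_pdivlMr// mulrBl mul1r divfK ?gt_eqF//.
    - rewrite ler_pdivrMr// mulrDl mul1r divfK ?gt_eqF//.
  have : n ^+ 2 * `|ln (s * t / n ^+ 2)| <= 2 * N ^+ 2.
    rewrite -ler_pdivlMl// (le_trans k)// le_eqVlt; apply/orP; left.
    by apply/eqP; field; rewrite gt_eqF.
  have : 0 <= 2 * N ^+ 2 * (ln_neg s + ln_neg t).
    by rewrite mulr_ge0// ?mulr_ge0 ?addr_ge0.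
  lra.
(* Near regime, without cancellation: [s] and [t] are at most [3 N] and [2 ln n] at most [4 N],
   whence [10 N]; the factor [n^2 < 2 N^2] turns this into [20 N^3]. *)
have nN : n <= 2 * N by rewrite -(@ler_pXn2r _ 2) ?nnegrE ?mulr_ge0 ?(ltW n0)//; nra.
have aux (r : R) : 0 <= r -> `|ln r| <= ln_neg r + r.
  move=> r0; rewrite (le_trans (normr_ln_le r0))// lerD2l le_ln1Dx//; lra.
have k : `|- ln s + - ln t + 2 * ln n| <= ln_neg s + ln_neg t + 10 * N.
  have as_ := aux s s0; have at_ := aux t t0.
  have ln_n : `|2 * ln n| <= 2 * n.
    rewrite ger0_norm ?mulr_ge0 ?ln_ge0// ler_pM2l// ltW// ln_sublinear//.
  rewrite (le_trans (ler_normD _ _))// (le_trans (lerD (ler_normD _ _) ln_n))//.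
  rewrite !normrN; lra.
rewrite (@le_trans _ _ (2 * N ^+ 2 * (ln_neg s + ln_neg t + 10 * N)))//.
  by rewrite ler_pM ?(ltW n20)// ltW.
have -> : N ^+ 3 = N ^+ 2 * N by rewrite exprSr.
by lra.
Qed.

End euclidean_norm.

(** A fixed region retaining some mass of [|u|^2]; a square rather than a disc, so that its measure
    is a product of lengths. *)
Definition unit_square (R : realType) :
    set (measurableTypeR R * measurableTypeR R)%type :=
  `[0, 1]%classic `*` `[0, 1]%classic.

Lemma measurable_unit_square (R : realType) : measurable (@unit_square R).
Proof. by apply: measurableX; exact: measurable_itv. Qed.

(** * Mass in the unit square and behaviour of integrable functions at infinity *)

Section square_integrable.
Variable R : realType.
Notation mu := (@lebesgue_measure R).
Notation mu2 := (@lebesgue2 R).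
Notation T2 := (measurableTypeR R * measurableTypeR R)%type.

Lemma lebesgue2_unit_square : mu2 (@unit_square R) = 1%E.
Proof.
have m01 : measurable (`[0, 1]%classic : set (measurableTypeR R)).
  exact: measurable_itv.
have e : mu `[0, 1]%classic = 1%E.
  by rewrite lebesgue_measure_itv/= lte_fin ltr01 oppr0 adde0.
transitivity (mu `[0%R, 1%R]%classic * mu `[0%R, 1%R]%classic)%E.
  exact: product_measure1E.
by rewrite e mule1.
Qed.

Lemma lebesgue2_half_strip (r : R) :
  mu2 (`[r, +oo[%classic `*` `[0, 1]%classic) = +oo%E.
Proof.
have m01 : measurable (`[0, 1]%classic : set (measurableTypeR R)).
  exact: measurable_itv.
have mr : measurable (`[r, +oo[%classic : set (measurableTypeR R)).
  exact: measurable_itv.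
transitivity (mu `[r, +oo[%classic * mu `[0%R, 1%R]%classic)%E.
  exact: product_measure1E.
by rewrite !lebesgue_measure_itv/= lte_fin ltr01 oppr0 adde0 ltry mule1.
Qed.

Variable f : T2 -> R.
Hypothesis f_ge0 : forall y, 0 <= f y.
Hypothesis f_int : mu2.-integrable setT (EFin \o f).

Let mf : measurable_fun setT f.
Proof. by apply/measurable_EFinP; exact: measurable_int f_int. Qed.

Lemma integrable_unit_square :
  mu2.-integrable setT (EFin \o (fun y : T2 => \1_(@unit_square R) y * f y)).
Proof.
apply: (le_integrable measurableT _ _ f_int) => /=.
  apply/measurable_EFinP.
  exact: (measurable_funM (measurable_indic (@measurable_unit_square R)) mf).
move=> y _; rewrite lee_fin normrM ler_piMl// indicE.
by case: (_ \in _); rewrite ?normr0 ?normr1.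
Qed.

Lemma integral_unit_square_le :
  \int[mu2]_y (\1_(@unit_square R) y * f y) <= \int[mu2]_y f y.
Proof.
apply: le_Rintegral => //; first exact: integrable_unit_square.
by move=> y _; rewrite indicE; case: (_ \in _); rewrite ?mul1r ?mul0r.
Qed.

Lemma integral_unit_square_gt0 (c : R) : 0 < c ->
  (forall y, unit_square y -> c <= f y) ->
  0 < \int[mu2]_y (\1_(@unit_square R) y * f y).
Proof.
move=> c0 fc.
have e : (\int[mu2]_y (c * \1_(@unit_square R) y)%:E = c%:E)%E.
  under eq_integral do rewrite EFinM.
  rewrite ge0_integralZl//=.
  - by rewrite integral_indic// ?setIT ?lebesgue2_unit_square ?mule1//;
      exact: measurable_unit_square.
  - apply/measurable_EFinP; apply: measurable_indic.
    exact: measurable_unit_square.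
  - by rewrite lee_fin ltW.
rewrite (lt_le_trans c0)// -lee_fin -e /Rintegral fineK; last first.
  exact: (integrable_fin_num measurableT integrable_unit_square).
apply: ge0_le_integral => //.
- by move=> y _; rewrite lee_fin mulr_ge0// ltW.
- apply/measurable_EFinP; apply: measurable_funM => //.
  by apply: measurable_indic; exact: measurable_unit_square.
- exact: measurable_int integrable_unit_square.
- move=> y _; rewrite lee_fin indicE.
  have [/set_mem/fc fy|_] := boolP (y \in _); last by rewrite mulr0 mul0r.
  by rewrite mulr1 mul1r.
Qed.

(** The half strip [[r, +oo[ x [0, 1]] avoids the open disc of radius [r] and has infinite
    measure. *)
Lemma integrable_not_ge1_at_infinity (r : R) :
  ~ (forall y, r <= enorm y -> 1 <= f y).
Proof.
move=> f1; have := integrable_lty measurableT f_int.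
suff : (+oo <= \int[mu2]_y (f y)%:E)%E by rewrite leye_eq => /eqP ->.
have mA : measurable (`[r, +oo[%classic `*` `[0, 1]%classic : set T2).
  by apply: measurableX; exact: measurable_itv.
rewrite -(lebesgue2_half_strip r).
rewrite -[leLHS](_ : (\int[mu2]_y
    (\1_(`[r, +oo[%classic `*` `[0%R, 1%R]%classic : set T2) y)%:E = _)%E); last first.
  by rewrite integral_indic// setIT.
apply: ge0_le_integral => //.
- by apply/measurable_EFinP; apply: measurable_indic.
- exact: measurable_int f_int.
- move=> y _; rewrite lee_fin indicE.
  have [/set_mem[/= + _]|//] := boolP (y \in _).
  rewrite in_itv/= andbT => ry; apply: f1.
  by rewrite (le_trans ry)// (le_trans (ler_norm _) (normr_fst_le_enorm y)).
Qed.

End square_integrable.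

(** * Convergence of the logarithmic potential and a first upper bound *)

Section log_potential.
Variable R : realType.
Notation mu := (@lebesgue_measure R).
Notation mu2 := (@lebesgue2 R).
Notation T2 := (measurableTypeR R * measurableTypeR R)%type.

Lemma measurable_ln_neg_enorm (x : R * R) :
  measurable_fun (setT : set T2) (fun y : T2 => ln_neg (enorm (x - y))).
Proof.
apply: (@measurable_maxr _ T2 R setT (fun=> 0)) => //.
apply: measurableT_comp => //; apply: measurableT_comp; first exact: measurable_ln.
exact: measurable_enormB.
Qed.

(** The majorant separates variables: [log_layers] in the second coordinate handles the singularity
    and [1 / (1 + y.1^2)] gives integrability in the first. Tonelli then yields the factors [4] and
    [pi]. *)
Lemma integral_ln_neg_le (g : T2 -> R) (x : R * R) (B : R) :
  measurable_fun setT g -> (forall y, 0 <= g y) -> 0 <= B ->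
  (forall y, enorm (x - y) < 1 -> g y * oneDsqr y.1 <= B) ->
  (\int[mu2]_y (ln_neg (enorm (x - y)) * g y)%:E <= (B * (pi * 4))%:E)%E.
Proof.
move=> mg g0 B0 gB.
pose h (y : T2) : \bar R :=
  (((oneDsqr y.1)^-1)%:E * log_layers (y.2 - x.2))%E.
have mdec : measurable_fun setT (fun t : R => ((oneDsqr t)^-1)%:E).
  apply/measurable_EFinP; apply: continuous_measurable_fun.
  exact: continuous_oneDsqrV.
have mlay : measurable_fun setT (fun t : R => log_layers (t - x.2)).
  apply: measurableT_comp; first exact: measurable_log_layers.
  exact: measurable_funB.
have dec0 (t : R) : 0 <= (oneDsqr t)^-1.
  by rewrite invr_ge0 (le_trans ler01)// oneDsqr_ge1.
have mh : measurable_fun setT h.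
  exact: (emeasurable_funM (measurableT_comp mdec measurable_fst)
    (measurableT_comp mlay measurable_snd)).
have h0 y : (0 <= h y)%E by rewrite mule_ge0// ?lee_fin ?log_layers_ge0.
apply: (@le_trans _ _ (\int[mu2]_y (B%:E * h y))%E).
  apply: ge0_le_integral => //.
  - by move=> y _; rewrite lee_fin mulr_ge0// ln_neg_ge0.
  - apply/measurable_EFinP/measurable_funM => //.
    exact: measurable_ln_neg_enorm.
  - exact: measurable_funeM.
  - move=> y _; have [y1|y1] := ltP (enorm (x - y)) 1; last first.
      by rewrite ln_neg_eq0// mul0r mule_ge0.
    rewrite /h muleA -EFinM [ln_neg _ * _]mulrC [(g y * _)%:E]EFinM.
    rewrite lee_pmul ?lee_fin ?ln_neg_ge0//.
      by rewrite ler_pdivlMr ?oneDsqr_gt0// gB.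
    apply: ln_neg_le_layers; rewrite distrC.
    exact: (normr_snd_le_enorm (x - y)).
rewrite ge0_integralZl//.
rewrite (@integral_lebesgue2_prod R _ _ mdec mlay)//; last first.
  by move=> t; exact: log_layers_ge0.
rewrite integral_oneDsqrV 2!EFinM !lee_wpmul2l ?lee_fin ?pi_ge0//.
exact: integral_log_layers.
Qed.

Variable u : R * R -> R.
Let f (y : T2) : R := `|u y| ^+ 2.
Hypothesis f_int : mu2.-integrable setT (EFin \o f).
Hypothesis f_ln :
  (\int[mu2]_y (ln (1 + enorm y) * `|u y| ^+ 2)%:E < +oo)%E.
Hypothesis f_loc : forall rho, exists B, forall y, enorm y <= rho -> f y <= B.

Let mf : measurable_fun setT f.
Proof. by apply/measurable_EFinP; exact: measurable_int f_int. Qed.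

Let f_ge0 y : 0 <= f y. Proof. exact: sqr_ge0. Qed.

Let menorm : measurable_fun (setT : set T2) (fun y : T2 => enorm y).
Proof.
have := @measurable_enormB R 0; apply: eq_measurable_fun => y _.
by rewrite sub0r enormN.
Qed.

Lemma integral_ln_neg_lty (x : R * R) :
  (\int[mu2]_y (ln_neg (enorm (x - y)) * f y)%:E < +oo)%E.
Proof.
have [B HB] := f_loc (enorm x + 1).
pose C := oneDsqr (enorm x + 1).
apply: (@le_lt_trans _ _ (`|B| * C * (pi * 4))%:E); last by rewrite ltry.
have C1 : 1 <= C by exact: oneDsqr_ge1.
apply: integral_ln_neg_le => //.
  by rewrite mulr_ge0// (le_trans ler01).
move=> y y1; have yn : enorm y <= enorm x + 1.
  have := ler_enorm_sub y x; rewrite enormBC; lra.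
rewrite ler_pM// ?(le_trans ler01 (oneDsqr_ge1 _))//.
  by rewrite (le_trans (HB y yn))// ler_norm.
rewrite /C /oneDsqr lerD2l (@le_trans _ _ (enorm y ^+ 2))//.
  by rewrite enorm_sqr lerDl sqr_ge0.
by rewrite ler_pXn2r ?nnegrE ?addr_ge0 ?enorm_ge0.
Qed.

Lemma measurable_log_conv (x : R * R) :
  measurable_fun setT (fun y : T2 => ln (1 / enorm (x - y)) * f y).
Proof.
apply: measurable_funM => //.
have : measurable_fun setT (fun y : T2 => - ln (enorm (x - y))).
  apply: measurable_funN.
  apply: measurableT_comp; first exact: measurable_ln.
  exact: measurable_enormB.
by apply: eq_measurable_fun => y _; rewrite ln_div1 ?enorm_ge0.
Qed.

(** [|ln |x - y||] is at most [ln_neg |x - y| + ln (1 + |y|) + ln (1 + |x|)]. The three integrals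
    against [f] are finite by local boundedness, by the logarithmic moment and by square
    integrability, respectively. *)
Lemma integrable_log_conv (x : R * R) :
  mu2.-integrable setT (EFin \o (fun y : T2 => ln (1 / enorm (x - y)) * f y)).
Proof.
apply/integrableP; split; first by apply/measurable_EFinP; exact: measurable_log_conv.
have mln : measurable_fun setT (fun y : T2 => ln (1 + enorm y) * f y).
  apply: measurable_funM => //; apply: measurableT_comp; first exact: measurable_ln.
  exact: measurable_funD.
have mneg : measurable_fun setT (fun y : T2 => ln_neg (enorm (x - y)) * f y).
  by apply: measurable_funM => //; exact: measurable_ln_neg_enorm.
have ln0 (y : T2) : 0 <= ln (1 + enorm y) by rewrite ln_ge0// lerDl enorm_ge0.
pose c := ln (1 + enorm x).
have c0 : 0 <= c by exact: ln0.
apply: (@le_lt_trans _ _ (\int[mu2]_y ((ln_neg (enorm (x - y)) * f y)%:E +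
  ((ln (1 + enorm y) * f y)%:E + (c * f y)%:E)))%E).
  apply: ge0_le_integral => //.
  - apply: measurableT_comp => //.
    by apply/measurable_EFinP; exact: measurable_log_conv.
  - apply: emeasurable_funD; first exact/measurable_EFinP.
    apply: emeasurable_funD; first exact/measurable_EFinP.
    by apply/measurable_EFinP; exact: measurable_funM.
  - move=> y _; rewrite -!EFinD lee_fin -!mulrDl normrM (ger0_norm (f_ge0 y)).
    rewrite ler_wpM2r// ln_div1 ?enorm_ge0// normrN.
    rewrite (le_trans (normr_ln_le (enorm_ge0 _)))// lerD2l.
    have x0 := enorm_ge0 x; have y0 := enorm_ge0 y.
    have -> : ln (1 + enorm y) + c = ln ((1 + enorm y) * (1 + enorm x)).
      by rewrite lnM ?posrE ?ltr_wpDr.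
    rewrite ler_ln ?posrE ?mulr_gt0 ?ltr_wpDr ?enorm_ge0//.
    have := ler_enormB x y; nra.
have m1 : measurable_fun setT (fun y : T2 => (ln_neg (enorm (x - y)) * f y)%:E).
  exact/measurable_EFinP.
have m2 : measurable_fun setT (fun y : T2 => (ln (1 + enorm y) * f y)%:E).
  exact/measurable_EFinP.
have m3 : measurable_fun setT (fun y : T2 => (c * f y)%:E).
  by apply/measurable_EFinP; exact: measurable_funM.
have p1 (y : T2) : setT y -> (0 <= (ln_neg (enorm (x - y)) * f y)%:E)%E.
  by move=> _; rewrite lee_fin mulr_ge0// ln_neg_ge0.
have p2 (y : T2) : setT y -> (0 <= (ln (1 + enorm y) * f y)%:E)%E.
  by move=> _; rewrite lee_fin mulr_ge0.
have p3 (y : T2) : setT y -> (0 <= (c * f y)%:E)%E.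
  by move=> _; rewrite lee_fin mulr_ge0.
rewrite (ge0_integralD mu2 measurableT p1 m1 _ (emeasurable_funD m2 m3)); last first.
  by move=> y yT; rewrite adde_ge0 ?p2 ?p3.
rewrite (ge0_integralD mu2 measurableT p2 m2 p3 m3).
rewrite lte_add_pinfty ?integral_ln_neg_lty// lte_add_pinfty//.
under eq_integral do rewrite EFinM.
rewrite (ge0_integralZl mu2 measurableT (measurable_int _ f_int)) ?lee_fin//.
  by rewrite lte_mul_pinfty//; exact: integrable_lty f_int.
by move=> y _; rewrite lee_fin f_ge0.
Qed.

Let integrable_ln_neg (x : R * R) :
  mu2.-integrable setT (EFin \o (fun y : T2 => ln_neg (enorm (x - y)) * f y)).
Proof.
apply/integrableP; split.
  apply/measurable_EFinP; apply: measurable_funM => //.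
  exact: measurable_ln_neg_enorm.
rewrite (le_lt_trans _ (integral_ln_neg_lty x))//.
under eq_integral do
  rewrite gee0_abs ?lee_fin ?mulr_ge0 ?ln_neg_ge0 ?f_ge0//.
by [].
Qed.

(** On the unit square [|y| <= 2 <= r / 2], so [|x - y| >= r / 2] and the kernel plus [ln (r / 2)]
    is nonpositive; elsewhere the kernel is at most [ln_neg]. *)
Let layers_ge (r t W : R) : 4 <= r -> 0 <= t <= 1 ->
  log_conv u (Num.sqrt (r ^+ 2 - t ^+ 2), t) = W ->
  ((W + ln (r / 2) * \int[mu2]_y (\1_(@unit_square R) y * f y))%:E <=
   \int[mu2]_y (log_layers (t - y.2)%R * (f y)%:E))%E.
Proof.
move=> r4 t01; set x := (_, t) => <-.
have r0 : 0 < r by lra.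
have xr : enorm x = r.
  have h : 0 <= r ^+ 2 - t ^+ 2 by nra.
  by rewrite /enorm/= sqr_sqrtr// subrK sqrtr_sqr gtr0_norm.
have int1 := integrable_log_conv x.
have int0 := integrable_unit_square f_int.
have int2 : mu2.-integrable setT
    (EFin \o (fun y : T2 => ln (r / 2) * (\1_(@unit_square R) y * f y))).
  exact: (integrableZl measurableT (ln (r / 2)) int0).
rewrite -(RintegralZl _ measurableT int0) /log_conv.
rewrite -(RintegralD measurableT int1 int2).
apply: (@le_trans _ _ (\int[mu2]_y (ln_neg (enorm (x - y)) * f y)%:E)%E).
  rewrite -(fineK (integrable_fin_num measurableT (integrable_ln_neg x))).
  rewrite lee_fin; apply: le_Rintegral => //.
    exact: (integrableD measurableT int1 int2).
  move=> y _.
  have fy := f_ge0 y; have ly := ln_neg_ge0 (enorm (x - y)).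
  rewrite ln_div1 ?enorm_ge0// indicE.
  have ln1 : - ln (enorm (x - y)) <= ln_neg (enorm (x - y)).
    by rewrite /ln_neg le_max lexx orbT.
  have [/set_mem[/= + +]|_] := boolP (y \in _); last first.
    by rewrite mul0r mulr0 addr0 ler_wpM2r.
  rewrite !in_itv/= => /andP[y11 y12] /andP[y21 y22].
  have yn : enorm y <= 2.
    rewrite -(@ler_pXn2r _ 2) ?nnegrE ?enorm_ge0// enorm_sqr; nra.
  have sr : r / 2 <= enorm (x - y).
    by have := ler_enorm_sub x y; rewrite xr; lra.
  have : ln (r / 2) <= ln (enorm (x - y)).
    by rewrite ler_ln ?posrE//; lra.
  move=> h; rewrite mul1r -mulrDl (@le_trans _ _ 0)// ?mulr_ge0//.
  by rewrite mulr_le0_ge0//; lra.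
have mlay : measurable_fun setT (fun y : T2 => log_layers (t - y.2)).
  apply: measurableT_comp; first exact: measurable_log_layers.
  by apply: measurable_funB => //; exact: measurable_snd.
apply: ge0_le_integral => //.
- by move=> y _; rewrite lee_fin mulr_ge0// ln_neg_ge0.
- exact: measurable_int (integrable_ln_neg x).
- by apply: emeasurable_funM => //; exact: measurable_int f_int.
- move=> y _; rewrite EFinM lee_wpmul2r ?lee_fin//.
  apply: ln_neg_le_layers.
  exact: (normr_snd_le_enorm (x - y)).
Qed.

(* The logarithmic singularity is only controlled on average over the circle,
   since [u] is not yet known to be bounded at infinity. *)
Lemma log_conv_circle_le (r W : R) : 4 <= r ->
  (forall t, 0 <= t <= 1 ->
     log_conv u (Num.sqrt (r ^+ 2 - t ^+ 2), t) = W) ->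
  W + ln (r / 2) * (\int[mu2]_y (\1_(@unit_square R) y * f y)) <=
  4 * (\int[mu2]_y f y).
Proof.
move=> r4 HW; set c := (X in X <= _).
have I0 : 0 <= \int[mu2]_y f y by apply: Rintegral_ge0 => y _.
(* A positive [c] may be treated as a nonnegative integrand over [[0, 1]], where its integral is [c]
   itself. *)
have [c0|c0] := leP c 0; first by rewrite (le_trans c0)// mulr_ge0.
pose h (z : measurableTypeR R * T2) := (log_layers (z.1 - z.2.2)%R * (f z.2)%:E)%E.
have mh : measurable_fun setT h.
  have m1 : measurable_fun setT
      (fun z : measurableTypeR R * T2 => log_layers (z.1 - z.2.2)).
    apply: measurableT_comp; first exact: measurable_log_layers.
    apply: measurable_funB; first exact: measurable_fst.
    exact: (measurableT_comp measurable_snd measurable_snd).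
  apply: (emeasurable_funM m1).
  exact: (measurableT_comp (measurable_int _ f_int) measurable_snd).
have h0 z : (0 <= h z)%E by rewrite mule_ge0 ?log_layers_ge0// lee_fin.
rewrite -lee_fin.
apply: (@le_trans _ _ (\int[mu]_(t in `[0%R, 1%R]) c%:E)%E).
  by rewrite integral_cst//= lebesgue_measure_itv/= lte_fin ltr01 oppr0 adde0 mule1.
apply: (@le_trans _ _ (\int[mu]_t \int[mu2]_y h (t, y))%E).
  have mK : measurable_fun setT (fun t => \int[mu2]_y h (t, y))%E.
    exact: (@measurable_fun_fubini_tonelli_F _ _ _ _ _ (@lebesgue2_sf R) h mh h0).
  apply: (@le_trans _ _ (\int[mu]_(t in `[0%R, 1%R]) \int[mu2]_y h (t, y))%E).
    apply: ge0_le_integral => //.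
    - by move=> t _; rewrite lee_fin ltW.
    - exact: measurable_funS mK.
    - move=> t; rewrite /= in_itv/= => t01.
      by apply: layers_ge => //; exact: HW.
  by apply: ge0_subset_integral => // t _; exact: integral_ge0.
(* Once the height [t] is integrated first, the singular factor contributes at most [4], uniformly
   in [y]. *)
have -> : (\int[mu]_t \int[mu2]_y h (t, y) = \int[mu2]_y \int[mu]_t h (t, y))%E.
  exact: (@fubini_tonelli _ _ _ _ _ mu (@lebesgue2_sf R) h mh h0).
apply: (@le_trans _ _ (\int[mu2]_y (4%:E * (f y)%:E))%E); last first.
  rewrite (ge0_integralZl mu2 measurableT (measurable_int _ f_int)) ?lee_fin//.
    by rewrite EFinM fineK//; exact: integrable_fin_num.
  by move=> y _; rewrite lee_fin.
apply: ge0_le_integral => //.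
- by move=> y _; exact: integral_ge0.
- exact: (@measurable_fun_fubini_tonelli_G _ _ _ _ _ mu h mh h0).
- by apply: measurable_funeM; exact: measurable_int f_int.
- move=> y _; rewrite /h/= ge0_integralZr ?lee_fin//; last 2 first.
  + apply: measurableT_comp; first exact: measurable_log_layers.
    exact: measurable_funB.
  + by move=> t _; exact: log_layers_ge0.
  by rewrite lee_wpmul2r ?lee_fin// integral_log_layers.
Qed.

End log_potential.

(** * Sharp expansion of the potential of a rapidly decaying density *)

Section log_potential_expansion.
Variable R : realType.
Notation mu := (@lebesgue_measure R).
Notation mu2 := (@lebesgue2 R).
Notation T2 := (measurableTypeR R * measurableTypeR R)%type.
Variable u : R * R -> R.
Let f (y : T2) : R := `|u y| ^+ 2.
Hypothesis f_int : mu2.-integrable setT (EFin \o f).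
Hypothesis f_ln :
  (\int[mu2]_y (ln (1 + enorm y) * `|u y| ^+ 2)%:E < +oo)%E.
Hypothesis f_loc : forall rho, exists B, forall y, enorm y <= rho -> f y <= B.

Let mf : measurable_fun setT f.
Proof. by apply/measurable_EFinP; exact: measurable_int f_int. Qed.

Let f_ge0 y : 0 <= f y. Proof. exact: sqr_ge0. Qed.

Variable B : R.
Hypothesis f_decay : forall y, (1 + enorm y ^+ 2) ^+ 4 * f y <= B.

Let B_ge0 : 0 <= B.
Proof.
rewrite (le_trans _ (f_decay 0))// mulr_ge0// exprn_ge0// addr_ge0//.
exact: sqr_ge0.
Qed.

Let f_decay2 y : (1 + enorm y ^+ 2) ^+ 2 * f y <= B.
Proof.
rewrite (le_trans _ (f_decay y))// ler_wpM2r// ler_weXn2l//.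
by rewrite lerDl sqr_ge0.
Qed.

(** The fourth power in [f_decay] splits as [2 + 2]: one square absorbs the polynomial weight, the
    other dominates the separated product, whose integral is [pi * pi]. *)
Let f_le_prod (y : T2) :
  (2 * enorm y ^+ 2 + 20 * enorm y ^+ 3) * f y <=
  22 * B * ((oneDsqr y.1)^-1 * (oneDsqr y.2)^-1).
Proof.
have N0 := enorm_ge0 y; have NE := enorm_sqr y.
have h1 : 2 * enorm y ^+ 2 + 20 * enorm y ^+ 3 <= 22 * (1 + enorm y ^+ 2) ^+ 2.
  by have := sqr_ge0 (enorm y ^+ 2 - enorm y); nra.
have h2 : oneDsqr y.1 * oneDsqr y.2 <= (1 + enorm y ^+ 2) ^+ 2.
  rewrite NE /oneDsqr; have := sqr_ge0 y.1; have := sqr_ge0 y.2.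
  move: (y.1 ^+ 2) (y.2 ^+ 2) => p q; nra.
rewrite (le_trans (ler_wpM2r (f_ge0 y) h1))//.
rewrite -[leLHS]mulrA -[leRHS]mulrA ler_pM2l//.
rewrite -invfM ler_pdivlMr ?mulr_gt0 ?oneDsqr_gt0//.
have := f_decay y; rewrite (exprD _ 2 2) => /(le_trans _); apply.
rewrite [leLHS]mulrAC ler_wpM2r// ler_wpM2l//.
by rewrite exprn_ge0// addr_ge0// sqr_ge0.
Qed.

Let g (y : T2) := 2 * enorm y ^+ 2 * f y.

Let menorm : measurable_fun (setT : set T2) (fun y : T2 => enorm y).
Proof.
have := @measurable_enormB R 0; apply: eq_measurable_fun => y _.
by rewrite sub0r enormN.
Qed.

Let g_ge0 y : 0 <= g y.
Proof. by rewrite mulr_ge0// mulr_ge0// sqr_ge0. Qed.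

Let mg : measurable_fun setT g.
Proof.
apply: measurable_funM => //; apply: measurable_funM => //.
exact: measurable_funX.
Qed.

Let integral_ln_neg_g (x : R * R) :
  (\int[mu2]_y (ln_neg (enorm (x - y)) * g y)%:E <= (2 * B * (pi * 4))%:E)%E.
Proof.
apply: integral_ln_neg_le => //; first by rewrite mulr_ge0.
move=> y _; have NE := enorm_sqr y.
have h : enorm y ^+ 2 * oneDsqr y.1 <= (1 + enorm y ^+ 2) ^+ 2.
  rewrite NE /oneDsqr; have := sqr_ge0 y.1; have := sqr_ge0 y.2.
  move: (y.1 ^+ 2) (y.2 ^+ 2) => p q; nra.
rewrite [leLHS](_ : _ = 2 * (enorm y ^+ 2 * oneDsqr y.1 * f y)).
  by rewrite ler_pM2l// (le_trans (ler_wpM2r _ h) (f_decay2 y)).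
by rewrite /g; ring.
Qed.

(** The polynomial part of the kernel bound, then one singular part at [x] and one at [- x]. *)
Let C := 22 * B * (pi * pi) + (2 * B * (pi * 4) + 2 * B * (pi * 4)).

(** Evenness makes twice the left-hand expression the integral of the symmetrized kernel against
    [f], to which the pointwise bound applies. *)
Lemma log_conv_expansion (x : R * R) :
  1 <= enorm x -> log_conv u (- x) = log_conv u x ->
  `|log_conv u x + (\int[mu2]_y f y) * ln (enorm x)| <= C / enorm x ^+ 2.
Proof.
move=> x1 ux.
have n2 : 0 < enorm x ^+ 2 by rewrite exprn_gt0// (lt_le_trans ltr01).
pose k (y : T2) := ln (1 / enorm (x - y)) + ln (1 / enorm (- x - y)) +
                   2 * ln (enorm x).
have i1 := integrable_log_conv f_int f_ln f_loc x.
have i2 := integrable_log_conv f_int f_ln f_loc (- x).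
pose f1 (z : R * R) (y : T2) := ln (1 / enorm (z - y)) * f y.
pose f3 (y : T2) := 2 * ln (enorm x) * f y.
have i3 : mu2.-integrable setT (EFin \o f3).
  exact: (integrableZl measurableT (2 * ln (enorm x)) f_int).
have i12 : mu2.-integrable setT (EFin \o (f1 x \+ f1 (- x))).
  exact: (integrableD measurableT i1 i2).
have kfE y : k y * f y = (f1 x \+ f1 (- x)) y + f3 y.
  by rewrite /k /f3 /f1 /=; ring.
have ik : mu2.-integrable setT (EFin \o (fun y => k y * f y)).
  have := integrableD measurableT i12 i3.
  by apply: eq_integrable => // y _; rewrite /= kfE EFinD.
have kE : 2 * (log_conv u x + (\int[mu2]_y f y) * ln (enorm x)) =
    \int[mu2]_y (k y * f y).
  under [RHS]eq_Rintegral do rewrite kfE.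
  rewrite (RintegralD measurableT i12 i3) (RintegralD measurableT i1 i2).
  rewrite (RintegralZl _ measurableT f_int).
  by rewrite -/(log_conv u x) -/(log_conv u (- x)) ux; ring.
have mdec : measurable_fun setT (fun t : R => ((oneDsqr t)^-1)%:E).
  apply/measurable_EFinP; apply: continuous_measurable_fun.
  exact: continuous_oneDsqrV.
have dec0 (t : R) : 0 <= (oneDsqr t)^-1.
  by rewrite invr_ge0 (le_trans ler01)// oneDsqr_ge1.
pose D (y : T2) := (((oneDsqr y.1)^-1)%:E * ((oneDsqr y.2)^-1)%:E)%E.
have D0 y : (0 <= D y)%E by rewrite mule_ge0// lee_fin.
have mD : measurable_fun setT D.
  exact: (emeasurable_funM (measurableT_comp mdec measurable_fst)
    (measurableT_comp mdec measurable_snd)).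
pose L (z : R * R) (y : T2) := (ln_neg (enorm (z - y)) * g y)%:E.
have L0 z y : (0 <= L z y)%E by rewrite lee_fin mulr_ge0// ln_neg_ge0.
have mL z : measurable_fun setT (L z).
  apply/measurable_EFinP.
  exact: (measurable_funM (measurable_ln_neg_enorm z) mg).
have mDB : measurable_fun setT (fun y => (22 * B)%:E * D y)%E.
  exact: measurable_funeM.
have mLL := emeasurable_funD (mL x) (mL (- x)).
have mkf : measurable_fun setT (fun y : T2 => (`|k y * f y|)%:E).
  apply/measurable_EFinP; apply: measurableT_comp => //.
  by apply/measurable_EFinP; exact: measurable_int ik.
have le_C : (\int[mu2]_y ((enorm x ^+ 2)%:E * (`|k y * f y|)%:E) <= C%:E)%E.
  apply: (@le_trans _ _
    (\int[mu2]_y ((22 * B)%:E * D y + (L x y + L (- x)%R y)))%E).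
    apply: ge0_le_integral => //.
    - by move=> y _; rewrite mule_ge0// lee_fin// ltW.
    - exact: measurable_funeM.
    - exact: (emeasurable_funD mDB mLL).
    - move=> y _; rewrite /L /D -!EFinM -!EFinD lee_fin.
      rewrite normrM (ger0_norm (f_ge0 y)) [leLHS]mulrA.
      have := ler_wpM2r (f_ge0 y) (sym_log_kernel_le y x1).
      move=> /le_trans; apply; rewrite mulrDl lerD//.
      rewrite -mulrDl [leLHS](_ : _ =
        (ln_neg (enorm (x - y)) + ln_neg (enorm (- x - y))) * g y)//.
      by rewrite /g; ring.
  rewrite (ge0_integralD mu2 measurableT _ mDB _ mLL)//; last 2 first.
  - by move=> y _; rewrite mule_ge0// lee_fin mulr_ge0.
  - by move=> y _; rewrite adde_ge0.
  rewrite (ge0_integralD mu2 measurableT _ (mL x) _ (mL (- x)))//.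
  rewrite (ge0_integralZl mu2 measurableT mD)// ?lee_fin ?mulr_ge0//.
  rewrite (@integral_lebesgue2_prod R _ _ mdec mdec)// integral_oneDsqrV.
  by rewrite /C !EFinD leeD ?EFinM// leeD//; exact: integral_ln_neg_g.
have n2E : (0 <= (enorm x ^+ 2)%:E)%E by rewrite lee_fin ltW.
rewrite (ge0_integralZl mu2 measurableT mkf _ n2E) in le_C; last first.
  by move=> y _; rewrite lee_fin.
have ikn : mu2.-integrable setT (EFin \o (fun y => `|k y * f y|)).
  exact: integrable_norm ik.
have kfin : (\int[mu2]_y (`|k y * f y|)%:E = (\int[mu2]_y `|k y * f y|)%:E)%E.
  by rewrite /Rintegral fineK//; exact: (integrable_fin_num measurableT ikn).
have le_C' : enorm x ^+ 2 * \int[mu2]_y `|k y * f y| <= C.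
  by rewrite -lee_fin EFinM -kfin; exact: le_C.
rewrite ler_pdivlMr// mulrC (le_trans _ le_C')// ler_pM2l//.
rewrite (le_trans _ (le_normr_Rintegral measurableT ik))// -kE normrM.
by rewrite ler_peMl// normr_nat ler1n.
Qed.

End log_potential_expansion.

(** * Radial solutions *)

Section radial_laplacian.
Variable R : realType.

(** Both derivatives are limits of the same difference quotient, since the second coordinate does
    not move. *)
Lemma is_derive_fst (f : R * R -> R) (g : R -> R) (x1 x2 d : R) :
  (forall t, f (t, x2) = g t) ->
  is_derive (x1, x2) ((1, 0) : R * R) f d <-> is_derive x1 (1 : R) g d.
Proof.
move=> fg.
have E :
    (fun h : R => h^-1 *: ((f \o shift (x1, x2)) (h *: ((1, 0) : R * R)) - f (x1, x2))) =
    (fun h : R => h^-1 *: ((g \o shift x1) (h *: 1) - g x1)).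
  apply/funext => h; rewrite /= -!fg; congr (_ *: (f _ - _)).
  by congr pair; rewrite /= ?scaler0 ?add0r.
have dE : derivable f (x1, x2) ((1, 0) : R * R) = derivable g x1 1.
  by rewrite /derivable E.
have DE : 'D_((1, 0) : R * R) f (x1, x2) = 'D_1 g x1 by rewrite /derive E.
by split=> -[h1 h2]; apply: DeriveDef; rewrite ?dE ?DE// -?dE -?DE.
Qed.

Lemma is_derive_snd (f : R * R -> R) (g : R -> R) (x1 x2 d : R) :
  (forall t, f (x1, t) = g t) ->
  is_derive (x1, x2) ((0, 1) : R * R) f d <-> is_derive x2 (1 : R) g d.
Proof.
move=> fg.
have E :
    (fun h : R => h^-1 *: ((f \o shift (x1, x2)) (h *: ((0, 1) : R * R)) - f (x1, x2))) =
    (fun h : R => h^-1 *: ((g \o shift x2) (h *: 1) - g x2)).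
  apply/funext => h; rewrite /= -!fg; congr (_ *: (f _ - _)).
  by congr pair; rewrite /= ?scaler0 ?add0r.
have dE : derivable f (x1, x2) ((0, 1) : R * R) = derivable g x2 1.
  by rewrite /derivable E.
have DE : 'D_((0, 1) : R * R) f (x1, x2) = 'D_1 g x2 by rewrite /derive E.
by split=> -[h1 h2]; apply: DeriveDef; rewrite ?dE ?DE// -?dE -?DE.
Qed.

Section profile.
Variables (v v1 v2 : R -> R) (c : R).
Hypothesis vd : forall r, is_derive r (1 : R) v (v1 r).
Hypothesis v1d : forall r, is_derive r (1 : R) v1 (v2 r).

Let rho t := Num.sqrt (t ^+ 2 + c ^+ 2).

Let rhod t : 0 < t ^+ 2 + c ^+ 2 -> is_derive t (1 : R) rho (t / rho t).
Proof.
move=> p; have d : is_derive t (1 : R) (fun t : R => t * t + c ^+ 2) _ :=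
  is_derive1_add (is_derive1_mul (is_derive_id t (1 : R)) (is_derive_id t (1 : R)))
    (is_derive1_cst (c ^+ 2) t).
have p' : 0 < t * t + c ^+ 2 by rewrite -expr2.
have := @is_derive1_chain R Num.sqrt (fun t => t * t + c ^+ 2) t _ _
  (is_derive1_sqrt p') d.
have -> : (fun r : R => Num.sqrt (r * r + c ^+ 2)) = rho.
  by apply/funext => r; rewrite /rho expr2.
move=> h; apply: (is_derive_eq h); rewrite /= -expr2 -/(rho t).
by field; rewrite gt_eqF// sqrtr_gt0.
Qed.

Lemma is_derive_profile t : 0 < t ^+ 2 + c ^+ 2 ->
  is_derive t (1 : R) (fun t => v (Num.sqrt (t ^+ 2 + c ^+ 2)))
    (v1 (rho t) * (t / rho t)).
Proof. by move=> p; apply: (is_derive1_chain (vd (rho t)) (rhod p)). Qed.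

Lemma is_derive2_profile t : 0 < t ^+ 2 + c ^+ 2 ->
  is_derive t (1 : R) (fun t => v1 (rho t) * (t / rho t))
    (v2 (rho t) * (t ^+ 2 / rho t ^+ 2) +
     v1 (rho t) * (1 / rho t - t ^+ 2 / rho t ^+ 3)).
Proof.
move=> p; have r0 : rho t != 0 by rewrite gt_eqF// sqrtr_gt0.
apply: (is_derive_eq (is_derive1_mul (is_derive1_chain (v1d (rho t)) (rhod p))
  (is_derive1_mul (is_derive_id t (1 : R)) (is_derive1_inv (rhod p) r0)))).
by rewrite /=; field.
Qed.

End profile.

Variable u : R * R -> R.
Hypothesis u_C2 : Ck 2 u.
Hypothesis u_rad : radially_symmetric u.

(** Restricting to the whole first axis, negative [r] included, keeps the profile differentiable at
    [0] and makes its derivatives partial derivatives of [u]. *)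
Definition profile r : R := u (r, 0).
Definition profile1 r : R := partial1 u (r, 0).
Definition profile2 r : R := partial1 (partial1 u) (r, 0).

Lemma is_derive_profile1 r : is_derive r (1 : R) profile (profile1 r).
Proof.
apply/(@is_derive_fst u profile r 0) => //.
by have [_ d _ _ _] := u_C2; exact/derivableP.
Qed.

Lemma is_derive_profile2 r : is_derive r (1 : R) profile1 (profile2 r).
Proof.
apply/(@is_derive_fst (partial1 u) profile1 r 0) => //.
by have [_ _ _ [_ d _ _ _] _] := u_C2; exact/derivableP.
Qed.

Lemma radial_profile x : u x = profile (enorm x).
Proof.
by apply: u_rad; rewrite {2}/enorm/= expr0n addr0 sqrtr_sqr ger0_norm// enorm_ge0.
Qed.

Let near_gt0 (t c : R) : 0 < t ^+ 2 + c ^+ 2 ->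
  \forall s \near t, 0 < s ^+ 2 + c ^+ 2.
Proof.
move=> p; have : continuous (fun s : R => s ^+ 2 + c ^+ 2).
  by move=> s; apply: cvgD; [exact: exprn_continuous|exact: cvg_cst].
by move=> /(_ t)/cvgr_gt; apply.
Qed.

Lemma laplacian_radial x : 0 < enorm x ->
  laplacian u x = profile2 (enorm x) + profile1 (enorm x) / enorm x.
Proof.
case: x => x1 x2 x0.
have p12 : 0 < x1 ^+ 2 + x2 ^+ 2 by move: x0; rewrite /enorm sqrtr_gt0.
have p21 : 0 < x2 ^+ 2 + x1 ^+ 2 by rewrite addrC.
pose v1 := profile1; pose v2 := profile2.
have P1 t c : 0 < t ^+ 2 + c ^+ 2 -> partial1 u (t, c) =
    v1 (Num.sqrt (t ^+ 2 + c ^+ 2)) * (t / Num.sqrt (t ^+ 2 + c ^+ 2)).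
  move=> p; apply: derive_val.
  apply/(is_derive_fst _ _ (fun t => radial_profile (t, c))).
  exact: (is_derive_profile is_derive_profile1 p).
have P2 t c : 0 < t ^+ 2 + c ^+ 2 -> partial2 u (c, t) =
    v1 (Num.sqrt (t ^+ 2 + c ^+ 2)) * (t / Num.sqrt (t ^+ 2 + c ^+ 2)).
  move=> p; apply: derive_val.
  apply/(is_derive_snd _ _ (fun t => radial_profile (c, t))).
  have := is_derive_profile is_derive_profile1 p.
  by congr is_derive; apply/funext => s; rewrite /enorm/= addrC.
rewrite /laplacian.
have -> : partial1 (partial1 u) (x1, x2) =
    v2 (enorm (x1, x2)) * (x1 ^+ 2 / enorm (x1, x2) ^+ 2) +
    v1 (enorm (x1, x2)) * (1 / enorm (x1, x2) - x1 ^+ 2 / enorm (x1, x2) ^+ 3).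
  apply: derive_val.
  apply/(is_derive_fst _ _ (fun t => erefl (partial1 u (t, x2)))).
  (* The formula [P1] for the first partial derivative is available only off the origin, so it is
     differentiated as a local equality. *)
  apply: near_eq_is_derive; last exact: (is_derive2_profile is_derive_profile2 p12).
  by near=> s; rewrite P1//; near: s; exact: near_gt0.
have -> : partial2 (partial2 u) (x1, x2) =
    v2 (enorm (x1, x2)) * (x2 ^+ 2 / enorm (x1, x2) ^+ 2) +
    v1 (enorm (x1, x2)) * (1 / enorm (x1, x2) - x2 ^+ 2 / enorm (x1, x2) ^+ 3).
  have -> : enorm (x1, x2) = Num.sqrt (x2 ^+ 2 + x1 ^+ 2) by rewrite /enorm addrC.
  apply: derive_val.
  apply/(is_derive_snd _ _ (fun t => erefl (partial2 u (x1, t)))).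
  apply: near_eq_is_derive; last exact: (is_derive2_profile is_derive_profile2 p21).
  by near=> s; rewrite P2//; near: s; exact: near_gt0.
have := enorm_sqr (x1, x2); move: x0; move: (enorm _) => e e0 /= eE.
rewrite -/v1 -/v2; have -> : x1 ^+ 2 = e ^+ 2 - x2 ^+ 2 by rewrite eE addrK.
by field; rewrite gt_eqF.
Unshelve. all: by end_near. Qed.

Variable a : R.
Hypothesis u_eq :
  forall x, - laplacian u x + a * u x = 1 / (2 * pi) * log_conv u x * u x.
Hypothesis u_gt0 : forall x, 0 < u x.

Lemma log_conv_radial x y : 0 < enorm x -> enorm x = enorm y ->
  log_conv u x = log_conv u y.
Proof.
move=> x0 xy; have y0 : 0 < enorm y by rewrite -xy.
have := u_eq x; have := u_eq y.
rewrite !laplacian_radial// !radial_profile xy => -> /eqP.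
have pi2 : 1 / (2 * pi) != 0 :> R.
  by rewrite gt_eqF// divr_gt0// mulr_gt0// pi_gt0.
have p0 : profile (enorm y) != 0 by rewrite gt_eqF// /profile.
by move=> /eqP/(mulIf p0)/(mulfI pi2).
Qed.

Definition potential r : R := a - 1 / (2 * pi) * log_conv u (r, 0).

Lemma profile_ode (r : R) : 0 < r ->
  profile2 r + profile1 r / r = potential r * profile r.
Proof.
move=> r0; have rE : enorm (r, 0 : R) = r.
  by rewrite /enorm/= expr0n addr0 sqrtr_sqr gtr0_norm.
have := u_eq (r, 0); rewrite laplacian_radial rE// /potential /profile => e.
by rewrite mulrBl -e; ring.
Qed.

Lemma is_derive_sqrt_profile (r : R) : 0 < r ->
  is_derive r (1 : R) (fun r => Num.sqrt r * profile r)
    ((2 * Num.sqrt r)^-1 * profile r + Num.sqrt r * profile1 r).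
Proof.
move=> r0.
exact: (is_derive1_mul (is_derive1_sqrt r0) (is_derive_profile1 r)).
Qed.

(* The Liouville substitution [w = sqrt r * v] removes the first-order term. *)
Lemma is_derive2_sqrt_profile (r : R) : 0 < r ->
  is_derive r (1 : R)
    (fun r => (2 * Num.sqrt r)^-1 * profile r + Num.sqrt r * profile1 r)
    ((potential r - 1 / (4 * r ^+ 2)) * (Num.sqrt r * profile r)).
Proof.
move=> r0; have s0 : 2 * Num.sqrt r != 0.
  by rewrite mulf_neq0// gt_eqF ?sqrtr_gt0.
have ds := is_derive1_sqrt r0.
have di := is_derive1_inv (is_derive1_mul (is_derive1_cst 2 r) ds) s0.
apply: (is_derive_eq (is_derive1_add (is_derive1_mul di (is_derive_profile1 r))
  (is_derive1_mul ds (is_derive_profile2 r)))).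
have := profile_ode r0 => /(canRL (addrK _)) ->; rewrite /=.
have rE : r = Num.sqrt r ^+ 2 by rewrite sqr_sqrtr// ltW.
have : Num.sqrt r != 0 by rewrite gt_eqF// sqrtr_gt0.
move: (potential r) (profile r) (profile1 r) => q p p1.
move: (Num.sqrt r) rE => s -> s_neq0; field.
by [].
Qed.

End radial_laplacian.

(** * The phase integral and the comparison of [a + M ln r] with [ln r] *)

Section phase.
Variable R : realType.
Notation mu := (@lebesgue_measure R).

Lemma is_derive_integral_sqrt_ln (x : R) : 1 < x ->
  is_derive x (1 : R) (fun x => \int[mu]_(s in `[1, x]) Num.sqrt (ln s))
    (Num.sqrt (ln x)).
Proof.
move=> x1.
have cf (s : R) : 0 < s -> {for s, continuous (fun s => Num.sqrt (ln s))}.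
  move=> s0; apply: continuous_comp; first exact: continuous_ln.
  exact: sqrt_continuous.
have xu : x < x + 1 by rewrite ltrDl.
(* Going beyond [x] makes it an interior point for the fundamental theorem of calculus. *)
have int : mu.-integrable `[1, x + 1] (EFin \o (fun s => Num.sqrt (ln s))).
  apply: continuous_compact_integrable; first exact: segment_compact.
  apply: continuous_in_subspaceT => s /set_mem/=; rewrite in_itv/= => /andP[s1 _].
  by apply: cf; exact: lt_le_trans s1.
have [||d e] := continuous_FTC1 xu int.
- by rewrite lte_fin.
- exact: cf (lt_trans ltr01 x1).
exact: (DeriveDef d (etrans (esym (derive1E _ _)) e)).
Qed.

Lemma is_derive_phase (a M r : R) : 0 < a -> 0 < M -> 1 < r ->
  is_derive r (1 : R)
    (fun r => Num.sqrt M * expR (- (a / M)) *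
      (\int[mu]_(s in `[1, expR (a / M) * r]) Num.sqrt (ln s)))
    (Num.sqrt (a + M * ln r)).
Proof.
move=> a0 M0 r1; have r0 := lt_trans ltr01 r1.
have e1 : 1 < expR (a / M) by rewrite expR_gt1 divr_gt0.
have er : 1 < expR (a / M) * r by rewrite -[1]mulr1 ltr_pM.
apply: (is_derive_eq (is_derive1_mul
  (is_derive1_cst (Num.sqrt M * expR (- (a / M))) r)
  (is_derive1_chain (is_derive_integral_sqrt_ln er)
    (is_derive1_scale (expR (a / M)) r)))).
rewrite mul0r add0r lnM ?posrE ?expR_gt0// expRK mulrACA -sqrtrM ?ltW//.
rewrite expRN mulVf ?gt_eqF ?expR_gt0// mulr1; congr Num.sqrt.
by field; rewrite gt_eqF.
Qed.

(** Allows [(a + M ln r)^(1/4)] to be replaced by [(ln r)^(1/4)], the factor [M^(1/4)] going into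
    [mu]. *)
Lemma cvg_log_shift (a M : R) : 0 < M ->
  ln ((a + M * ln r) / ln r) @[r --> +oo] --> ln M.
Proof.
move=> M0.
have lny : ln r @[r --> +oo] --> (+oo : set_system R).
  apply/cvgryPge => A; near=> r.
  have e : expR A <= r by near: r; apply: nbhs_pinfty_ge; rewrite num_real.
  by rewrite -[A]expRK ler_ln ?posrE ?expR_gt0// (lt_le_trans (expR_gt0 A)).
have inv0 : (ln r)^-1 @[r --> +oo] --> (0 : R).
  apply/gtr0_cvgV0 => //.
  by near=> r; rewrite ln_gt0.
have h : a * (ln r)^-1 + M @[r --> +oo] --> M.
  have := cvgD (cvgM (cvg_cst a) inv0) (cvg_cst M).
  by rewrite mulr0 add0r; apply.
apply: (@cvg_trans _ (ln (a * (ln r)^-1 + M) @[r --> +oo])).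
  apply: near_eq_cvg; near=> r; congr ln.
  have l0 : ln r != 0.
    by rewrite gt_eqF// ln_gt0.
  by field.
apply: (continuous_cvg _ _ h); exact: continuous_ln.
Unshelve. all: by end_near. Qed.

Lemma cvg_enorm_infty : @enorm R x @[x --> @enorm_infty R] --> +oo.
Proof.
move=> A [K [_ KA]]; exists K => // x Kx; exact: KA.
Qed.

End phase.

(** * Decay and asymptotics of the given solution *)

Section asymptotics.
Variables (R : realType) (a : R) (u : R * R -> R).
Notation mu2 := (@lebesgue2 R).
Hypothesis a_gt0 : 0 < a.
Hypothesis uX : spaceX u.
Hypothesis u_sol : is_solution a u.
Hypothesis u_rad : radially_symmetric u.
Hypothesis u_gt0 : forall x, 0 < u x.

Let f (y : R * R) := `|u y| ^+ 2.
Let v := profile u.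
Let W (r : R) := log_conv u (r, 0).
Let I := \int[mu2]_x (`|u x| ^+ 2).
Let M := 1 / (2 * pi) * I.

Let u_C2 : Ck 2 u := u_sol.1.

Let f_int : mu2.-integrable setT (EFin \o f).
Proof.
have [[u2 _] _] := uX; have := Lfun2_integrable_sqr u2.
by apply: eq_integrable => // y _; rewrite /= /f real_normK ?num_real.
Qed.

Let f_ln : (\int[mu2]_y (ln (1 + enorm y) * `|u y| ^+ 2)%:E < +oo)%E.
Proof. exact: uX.2. Qed.

Let v_gt0 (r : R) : 0 < v r. Proof. exact: u_gt0. Qed.

Let fE y : f y = v (enorm y) ^+ 2.
Proof. by rewrite /f (radial_profile u_rad) ger0_norm// ltW. Qed.

Let v_cont rho : {within `[0, rho], continuous v}.
Proof.
apply: continuous_in_subspaceT => r _.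
apply: differentiable_continuous; apply/derivable1_diffP.
exact: (@ex_derive _ _ _ _ _ _ _ (is_derive_profile1 u_C2 r)).
Qed.

Let f_loc rho : exists B, forall y, enorm y <= rho -> f y <= B.
Proof.
have [r0|r0] := leP 0 rho; last first.
  by exists 0 => y /le_lt_trans/(_ r0); rewrite ltNge enorm_ge0.
have [c _ vc] := EVT_max r0 (@v_cont rho).
exists (v c ^+ 2) => y yr; rewrite fE ler_pXn2r ?nnegrE ?(ltW (v_gt0 _))//.
by apply: vc; rewrite in_itv/= enorm_ge0.
Qed.

Let m := \int[mu2]_y (\1_(@unit_square R) y * f y).

Let m_gt0 : 0 < m.
Proof.
have [c _ vc] := EVT_min (ler0n R 2) (@v_cont 2).
apply: (@integral_unit_square_gt0 R f f_int (v c ^+ 2)).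
  by rewrite exprn_gt0.
move=> y [/=]; rewrite !in_itv/= => /andP[y11 y12] /andP[y21 y22].
rewrite fE ler_pXn2r ?nnegrE ?(ltW (v_gt0 _))//.
apply: vc; rewrite in_itv/= enorm_ge0/=.
by rewrite -(@ler_pXn2r _ 2) ?nnegrE ?enorm_ge0// enorm_sqr; nra.
Qed.

Let I_gt0 : 0 < I.
Proof.
apply: (lt_le_trans m_gt0); apply: (integral_unit_square_le _ f_int) => y.
exact: sqr_ge0.
Qed.

Let M_gt0 : 0 < M.
Proof. by rewrite mulr_gt0// divr_gt0// mulr_gt0// pi_gt0. Qed.

Let enorm_axis (r : R) : 0 <= r -> enorm (r, 0 : R) = r.
Proof. by move=> r0; rewrite /enorm/= expr0n addr0 sqrtr_sqr ger0_norm. Qed.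

Let W_le (r : R) : 4 <= r -> W r + ln (r / 2) * m <= 4 * I.
Proof.
move=> r4; have r0 : 0 < r by lra.
apply: (log_conv_circle_le f_int f_ln f_loc r4) => t t01.
have xr : enorm (Num.sqrt (r ^+ 2 - t ^+ 2), t) = r.
  have h : 0 <= r ^+ 2 - t ^+ 2 by nra.
  by rewrite /enorm/= sqr_sqrtr// subrK sqrtr_sqr gtr0_norm.
by apply: (log_conv_radial u_C2 u_rad u_sol.2 u_gt0); rewrite xr// enorm_axis// ltW.
Qed.

Let q (r : R) := potential u a r - 1 / (4 * r ^+ 2).

Let q_ge1 : exists2 r0, 1 <= r0 & forall r, r0 < r -> 1 <= q r.
Proof.
(* Chosen so that [ln (r / 2) >= b] forces [W r <= - 6 pi], hence [- W r / (2 pi) >= 3], which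
   leaves room for [1 / (4 r^2) <= 1]. *)
pose b := (4 * I + 6 * pi) / m.
exists (Num.max 4 (2 * expR b)); first by rewrite le_max; apply/orP; left; lra.
move=> r; rewrite gt_max => /andP[r4 rb].
have p0 := pi_gt0 R.
have : b <= ln (r / 2).
  rewrite -[b]expRK ler_ln ?posrE ?expR_gt0//; last by lra.
  by rewrite ler_pdivlMr// mulrC ltW.
rewrite /b ler_pdivrMr// => h; have := W_le (ltW r4) => hW.
have e : 1 / (4 * r ^+ 2) <= 1.
  rewrite ler_pdivrMr; first by nra.
  by rewrite mulr_gt0// exprn_gt0//; lra.
have : 3 <= - (1 / (2 * pi) * W r).
  rewrite -mulrN mul1r mulrC ler_pdivlMr ?mulr_gt0//; lra.
by rewrite /q /potential -/(W r); have := a_gt0; lra.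
Qed.

Let w (r : R) := Num.sqrt r * v r.
Let w1 (r : R) := (2 * Num.sqrt r)^-1 * v r + Num.sqrt r * profile1 u r.

Let w_gt0 (r : R) : 0 < r -> 0 < w r.
Proof. by move=> r0; rewrite mulr_gt0// sqrtr_gt0. Qed.

Let wd (r : R) : 0 < r -> is_derive r (1 : R) w (w1 r).
Proof. exact: is_derive_sqrt_profile. Qed.

Let w1d (r : R) : 0 < r -> is_derive r (1 : R) w1 (q r * w r).
Proof. exact: (is_derive2_sqrt_profile u_C2 u_rad u_sol.2). Qed.

Let w1_le0 r0 : 1 <= r0 -> (forall r, r0 < r -> 1 <= q r) ->
  forall r, r0 < r -> w1 r <= 0.
Proof.
move=> r01 q1 r1 r0r1; rewrite leNgt; apply/negP => w1_gt0.
have pos (r : R) : r0 < r -> 0 < r by lra.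
have growth := ode_linear_growth (fun r h => wd (pos r h))
  (fun r h => w1d (pos r h)) (fun r h => w_gt0 (pos r h)) q1 r0r1 w1_gt0.
have r1_gt0 := pos _ r0r1.
set al := w1 r1 in w1_gt0 growth; set b := r1 + 1 in growth.
have b0 : 0 < b by rewrite addr_gt0.
(* Beyond this radius [r - b >= r / 2] and [al sqrt r >= 2], so [w r >= al r / 2 >= sqrt r], that is
   [v r >= 1]. *)
apply: (@integrable_not_ge1_at_infinity R f (fun y => sqr_ge0 _) f_int
  (2 * b + (2 / al) ^+ 2)).
move=> y; set r := enorm y => yr; rewrite fE -/r.
have al2 : 0 < 2 / al by rewrite divr_gt0.
have br : 2 * b <= r by have := sqr_ge0 (2 / al); lra.
have r_gt0 : 0 < r by lra.
have sr : 2 / al <= Num.sqrt r.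
  rewrite -(@ler_pXn2r _ 2) ?nnegrE ?sqrtr_ge0 ?(ltW al2)//.
  by rewrite sqr_sqrtr ?(ltW r_gt0)//; lra.
have s0 : 0 < Num.sqrt r by rewrite sqrtr_gt0.
have := growth r ltac:(lra).
have rE : r = Num.sqrt r ^+ 2 by rewrite sqr_sqrtr// ltW.
have sal : 2 <= Num.sqrt r * al by rewrite -ler_pdivrMr.
move=> g; have v1 : 1 <= v r.
  rewrite -(ler_pM2l s0) mulr1 -/(w r) (le_trans _ g)//.
  have : al * (r / 2) <= al * (r - b) by rewrite ler_pM2l//; lra.
  by apply: le_trans; rewrite {2}rE; nra.
by rewrite exprn_ege1.
Qed.

Let f_decay : exists B, forall y, (1 + enorm y ^+ 2) ^+ 4 * f y <= B.
Proof.
have [r0 r01 q1] := q_ge1; have w10 := w1_le0 r01 q1.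
have pos (r : R) : r0 < r -> 0 < r by lra.
pose r1 := r0 + 1; have r0r1 : r0 < r1 by rewrite ltrDl.
have decay := @ode_exp_decay R w w1 q r0 (fun r h => wd (pos r h))
  (fun r h => w1d (pos r h)) (fun r h => w_gt0 (pos r h)) q1 w10 r1 ^~ r0r1.
have [B1 B1P] := f_loc r1.
pose A := w r1 * expR r1.
have A0 : 0 <= A by rewrite mulr_ge0 ?expR_ge0// ltW// w_gt0// pos.
exists ((1 + r1 ^+ 2) ^+ 4 * `|B1| + A ^+ 2 * 4 ^+ 8) => y.
have N0 := enorm_ge0 y; set N := enorm y in N0 *.
have f0 : 0 <= f y by exact: sqr_ge0.
have s1 (t : R) : 0 <= 1 + t ^+ 2 by rewrite addr_ge0// sqr_ge0.
have [Nr|rN] := leP N r1.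
  apply: (@le_trans _ _ ((1 + r1 ^+ 2) ^+ 4 * `|B1|)); last first.
    by rewrite lerDl mulr_ge0// exprn_ge0.
  apply: ler_pM => //; first by rewrite exprn_ge0.
    rewrite ler_pXn2r ?nnegrE// lerD2l ler_pXn2r ?nnegrE//.
    by rewrite (le_trans N0).
  by rewrite (le_trans (B1P y Nr))// ler_norm.
apply: (@le_trans _ _ (A ^+ 2 * 4 ^+ 8)); last first.
  by rewrite lerDr mulr_ge0// exprn_ge0.
have N1 : 1 <= N by rewrite /r1 in rN; lra.
have vA : v N <= A * expR (- N).
  have -> : A * expR (- N) = w r1 * expR (r1 - N) by rewrite /A -mulrA -expRD.
  rewrite (le_trans _ (decay N (ltW rN)))// /w ler_peMl ?(ltW (v_gt0 _))//.
  by rewrite -[leLHS](@sqrtr1 R) ler_sqrt.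
(* The rate [N / 4] in [1 + N <= 4 exp(N / 4)] makes the eighth power equal to [4^8 exp(2 N)],
   exactly offset by the square of [v N <= A exp(- N)]. *)
have eN : (1 + N ^+ 2) ^+ 4 <= 4 ^+ 8 * expR N ^+ 2.
  have h1 : (1 + N ^+ 2) ^+ 4 <= (1 + N) ^+ 8.
    rewrite (exprM _ 2 4) ler_pXn2r ?nnegrE ?exprn_ge0 ?addr_ge0//; nra.
  have h2 : 1 + N <= 4 * expR (N / 4) by have := expR_ge1Dx (N / 4); lra.
  have -> : expR N ^+ 2 = expR (N / 4) ^+ 8.
    by rewrite -!expRM_natl; congr expR; field.
  rewrite (le_trans h1)// -exprMn lerXn2r// nnegrE.
    by rewrite addr_ge0.
  by rewrite mulr_ge0 ?expR_ge0.
have fA : f y <= (A * expR (- N)) ^+ 2.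
  rewrite fE ler_pXn2r ?nnegrE ?(ltW (v_gt0 _))// mulr_ge0 ?expR_ge0//.
rewrite (le_trans (ler_pM _ f0 eN fA)) ?exprn_ge0//.
rewrite le_eqVlt; apply/orP; left; apply/eqP.
rewrite expRN; field; by rewrite gt_eqF ?expR_gt0.
Qed.

Let S (r : R) := Num.sqrt M * expR (- (a / M)) *
  (\int[@lebesgue_measure R]_(s in `[1, expR (a / M) * r]) Num.sqrt (ln s)).

Let L_cvg : exists l : R,
  ln (w r) + S r + ln (a + M * ln r) / 4 @[r --> +oo] --> l.
Proof.
have [r0 r01 q1] := q_ge1; have [B HB] := f_decay.
pose C := 22 * B * (pi * pi) + (2 * B * (pi * 4) + 2 * B * (pi * 4)).
have WI (r : R) : 1 <= r -> `|W r + I * ln r| <= C / r ^+ 2.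
  move=> r1; have rp := lt_le_trans ltr01 r1.
  have rE := enorm_axis (ltW rp).
  rewrite -{2 3}rE; apply: (log_conv_expansion f_int f_ln f_loc HB).
    by rewrite rE.
  by apply: (log_conv_radial u_C2 u_rad u_sol.2 u_gt0); rewrite enormN rE.
(* Beyond [exp(1/M)] one has [M ln r > 1], hence [a + M ln r >= 1]. *)
pose r1 := Num.max r0 (expR M^-1).
have r0r1 (r : R) : r1 < r -> r0 < r by rewrite gt_max => /andP[].
have pos (r : R) : r1 < r -> 0 < r by move/r0r1; lra.
(* The error constant adds that of the potential to the [1/4] of the Liouville substitution. *)
apply: (@wkb_asymptotics R a M (1 / (2 * pi) * C + 1 / 4) r1 w w1 q S M_gt0).
- by rewrite le_max r01.
- by move=> r /pos; exact: wd.
- by move=> r /pos; exact: w1d.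
- by move=> r /pos; exact: w_gt0.
- by move=> r /r0r1; exact: w1_le0.
- by move=> r /r0r1; exact: q1.
- move=> r; rewrite gt_max => /andP[_ rM].
  have : M^-1 < ln r.
    by rewrite -[M^-1]expRK ltr_ln ?posrE ?expR_gt0// (lt_trans (expR_gt0 _) rM).
  by rewrite -(ltr_pM2l M_gt0) divff ?gt_eqF//; have := a_gt0; lra.
- by move=> r rr; apply: is_derive_phase => //; have := r0r1 r rr; lra.
- move=> r rr; have rp := pos r rr.
  have pp : 0 < 1 / (2 * pi) :> R by rewrite divr_gt0// mulr_gt0// pi_gt0.
  have -> : q r - (a + M * ln r) =
      - (1 / (2 * pi) * (W r + I * ln r)) - 1 / (4 * r ^+ 2).
    by rewrite /q /potential -/(W r) /M; ring.
  rewrite (le_trans (ler_normB _ _))// [leRHS]mulrDl lerD//.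
    rewrite normrN normrM (gtr0_norm pp) -[leRHS]mulrA ler_pM2l// WI//.
    by have := r0r1 r rr; lra.
  rewrite ger0_norm; last by rewrite divr_ge0// mulr_ge0// sqr_ge0.
  by rewrite invfM mulrA.
Qed.

Lemma radial_asymptotics : exists2 mu : R, 0 < mu &
  v r * (Num.sqrt r * ln r `^ (1 / 4)) * expR (S r) @[r --> +oo] --> mu.
Proof.
(* The shift [- ln M / 4] is the price of trading [Q] for [ln r]. *)
have [l Ll] := L_cvg; exists (expR (l - ln M / 4)); first exact: expR_gt0.
have h : ln (w r) + S r + ln (a + M * ln r) / 4 -
    ln ((a + M * ln r) / ln r) * 4^-1 @[r --> +oo] --> l - ln M / 4.
  exact: (cvgB Ll (cvgM (cvg_log_shift a M_gt0) (cvg_cst (4^-1 : R)))).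
have eh : expR (ln (w r) + S r + ln (a + M * ln r) / 4 -
    ln ((a + M * ln r) / ln r) * 4^-1) @[r --> +oo] --> expR (l - ln M / 4).
  by apply: (continuous_cvg _ _ h); exact: continuous_expR.
apply: cvg_trans eh.
apply: near_eq_cvg; near=> r.
have r1 : 1 < r by near: r; apply: nbhs_pinfty_gt; rewrite num_real.
have r0 := lt_trans ltr01 r1.
have lr : 0 < ln r by rewrite ln_gt0.
have Qr : 0 < a + M * ln r by rewrite addr_gt0// mulr_gt0.
rewrite /= ln_div ?posrE//.
have -> : ln r `^ (1 / 4) = expR (1 / 4 * ln (ln r)) by rewrite /powR gt_eqF.
have -> : v r * (Num.sqrt r * expR (1 / 4 * ln (ln r))) * expR (S r) =
    expR (ln (w r)) * expR (1 / 4 * ln (ln r)) * expR (S r).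
  by rewrite lnK ?posrE ?w_gt0// /w; ring.
by rewrite -!expRD; congr expR; field.
Unshelve. all: by end_near. Qed.

End asymptotics.

Theorem theorem2 (R : realType) (a : R) (u : R * R -> R)
  (a_gt0 : 0 < a)
  (uX : spaceX u)
  (u_sol : is_solution a u)
  (u_rad : radially_symmetric u)
  (u_gt0 : forall x, 0 < u x) :
  let M := 1 / (2 * pi) * (\int[@lebesgue2 R]_x (`|u x| ^+ 2)) in
  exists2 mu : R, 0 < mu &
  exists2 eps : R * R -> R, eps x @[x --> @enorm_infty R] --> (0 : R) &
  \forall x \near @enorm_infty R,
    u x = (mu + eps x) / (Num.sqrt (enorm x) * ln (enorm x) `^ (1 / 4)) *
          expR (- (Num.sqrt M * expR (- (a / M)) *
                   (\int[@lebesgue_measure R]_(s in `[1, expR (a / M) * enorm x])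
                      Num.sqrt (ln s)))).
Proof.
move=> M.
have [mu mu_gt0 vmu] := radial_asymptotics a_gt0 uX u_sol u_rad u_gt0.
exists mu => //.
pose G r := profile u r * (Num.sqrt r * ln r `^ (1 / 4)) *
  expR (Num.sqrt M * expR (- (a / M)) *
    (\int[@lebesgue_measure R]_(s in `[1, expR (a / M) * r]) Num.sqrt (ln s))).
(* Solving the claimed identity for the error term makes it exact, and leaves only [G -> mu] to be
   used. *)
exists (fun x => G (enorm x) - mu).
  rewrite -(subrr mu); apply: cvgB; last exact: cvg_cst.
  exact: (cvg_comp _ _ (@cvg_enorm_infty R) vmu).
(* For [|x| > 1] the logarithm is positive, so the denominator does not vanish. *)
exists 1 => // x /= x1.
have x0 : 0 < enorm x by rewrite (lt_trans ltr01).
have D0 : Num.sqrt (enorm x) * ln (enorm x) `^ (1 / 4) != 0.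
  have s0 : 0 < Num.sqrt (enorm x) by rewrite sqrtr_gt0.
  by rewrite gt_eqF// mulr_gt0// powR_gt0// ln_gt0.
rewrite [mu + _]addrC subrK /G -(radial_profile u_rad).
move: (Num.sqrt (enorm x) * _) D0 (Num.sqrt M * _ * _) => D D0 X.
by rewrite expRN; field; rewrite D0 gt_eqF ?expR_gt0.
Qed.
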